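(* Let $\gamma>0$ and let $\hat r_n$ be defined by $\hat r_n^d = \frac{\gamma\log n}{\alpha n}$. Suppose $g(r) = o(r^{-c})$ as $r\to\infty$ for some $c>d$. Let $D_n(k)$ be the number of vertices in $G_n(\hat r_n)$ of degree at least $k$. Then $$E\left[\frac{D_n(k_n)}{n}\right] \to 1-\Phi(d) \quad\text{as } n\to\infty,$$ where $k_n = \alpha n\hat r_n^d + d\sqrt{\alpha n\hat r_n^d}$ and $\Phi$ is the standard normal distribution function.
   Context: Let $d \ge 2$ and $S = \left(-\frac12,\frac12\right]^d$, equipped with the toroidal metric $d(x,y) = \inf\{|x-y-z| : z \in \mathbb{Z}^d\}$, where $|\cdot|$ is the Euclidean norm. (The letter $d$ denotes the dimension; $d(\cdot,\cdot)$ denotes the metric.) The connection function $g:[0,\infty)\to[0,1]$ is non-increasing with $0 < \alpha := \int_{\mathbb{R}^d} g(|x|)\,dx < \infty$. On one probability space $(\Omega,\mathcal{F},P)$ let $X_1,X_2,\ldots$ be independent and uniformly distributed on $S$; let $\{N_n\}_{n\ge1}$ be a non-decreasing sequence of random variables with $N_n$ Poisson of mean $n$; and let $\{U_{ij}\}$ be independent uniform random variables on $[0,1]$; these three families are independent of each other. Set $\mathcal{P}_n = \{X_1,\ldots,X_{N_n}\}$, a Poisson point process of intensity $n$ on $S$. For $r>0$, $G_n(r)$ is the (undirected) graph with vertex set $\mathcal{P}_n$ in which $X_i,X_j\in\mathcal{P}_n$, $i<j$, are joined by an edge iff $U_{ij} \le g\left(\frac{d(X_i,X_j)}{r}\right)$.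 *)

(* Defs.v *)
From HB Require Import structures.
From mathcomp Require Import all_boot all_order all_algebra finmap.
From mathcomp Require Import all_classical all_reals all_analysis.
From mathcomp Require Import lra.

Set Implicit Arguments.
Unset Strict Implicit.
Unset Printing Implicit Defensive.

Import Order.TTheory GRing.Theory Num.Theory.
Import numFieldNormedType.Exports.

Local Open Scope classical_set_scope.
Local Open Scope ring_scope.

(* Makes the Landau notations usable at +oo. *)
Canonical pinfty_nbhs_filterType (R : realType) :=
  FilterType (pinfty_nbhs R) _.

(* The sigma-algebra on n.-tuple R provided by the library is the product of   *)
(* the Borel sigma-algebras, so n.-tuple R plays the role of R^n; its Lebesgue *)
(* measure is built by iterating the binary product measure.                   *)
Section lebesgue_tuple.
Context {R : realType}.

Definition tcons n (p : R * n.-tuple R) : n.+1.-tuple R := cons_tuple p.1 p.2.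

Lemma measurable_tcons n : measurable_fun [set: R * n.-tuple R] (@tcons n).
Proof. exact: measurable_cons. Qed.

Section step.
Variables (n : nat) (m : {sigma_finite_measure set (n.-tuple R) -> \bar R}).

Definition lebesgue_step : set (n.+1.-tuple R) -> \bar R :=
  pushforward (@lebesgue_measure R \x m)%E (@tcons n).

Let lebesgue_step0 : lebesgue_step set0 = 0%E.
Proof. by rewrite /lebesgue_step /pushforward preimage_set0 measure0. Qed.

Let lebesgue_step_ge0 A : (0 <= lebesgue_step A)%E.
Proof. exact: (@measure_ge0 _ _ _ (@lebesgue_measure R \x m)%E). Qed.

Let lebesgue_step_sigma_additive : semi_sigma_additive lebesgue_step.
Proof.
apply: (@measure_semi_sigma_additive _ _ _
  (pushforward (@lebesgue_measure R \x m)%E (@tcons n))).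
Unshelve. exact: measurable_tcons.
Qed.

HB.instance Definition _ := isMeasure.Build _ _ _ lebesgue_step
  lebesgue_step0 lebesgue_step_ge0 lebesgue_step_sigma_additive.

Let lebesgue_step_sigma_finite : sigma_finite [set: n.+1.-tuple R] lebesgue_step.
Proof.
have /sigma_finiteP[F [TF ndF Foo]] := sigma_finiteT (@lebesgue_measure R).
have /sigma_finiteP[G [TG ndG Goo]] := sigma_finiteT m.
exists (fun k => [set t : n.+1.-tuple R | F k (thead t)] `&`
                 [set t : n.+1.-tuple R | G k [tuple of behead t]]).
  apply/seteqP; split => // t _.
  have [i _ Fi] : (\bigcup_k F k) (thead t) by rewrite -TF.
  have [j _ Gj] : (\bigcup_k G k) [tuple of behead t] by rewrite -TG.
  exists (maxn i j) => //; split => /=.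
    by move: Fi; exact/subsetPset/ndF/leq_maxl.
  by move: Gj; exact/subsetPset/ndG/leq_maxr.
move=> k; have [mF Fkoo] := Foo k; have [mG Gkoo] := Goo k; split.
  apply: measurableI; rewrite -[X in measurable X]setTI.
    exact: measurable_tnth.
  exact: measurable_behead.
rewrite /lebesgue_step /pushforward [X in (_ X < _)%E](_ : _ = F k `*` G k).
  by rewrite product_measure1E// lte_mul_pinfty// ge0_fin_numE.
by apply/seteqP; split => -[x t]/=; rewrite theadE (_ : [tuple of _] = t)//;
  exact/val_inj.
Qed.

HB.instance Definition _ := Measure_isSigmaFinite.Build _ _ _ lebesgue_step
  lebesgue_step_sigma_finite.

End step.

Fixpoint lebesgue_tuple n : {sigma_finite_measure set (n.-tuple R) -> \bar R} :=
  if n is n'.+1 then lebesgue_step (lebesgue_tuple n')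
  else \d_([tuple] : 0.-tuple R).

Lemma lebesgue_tuple_box n (A : 'I_n -> set R) :
  (forall i, measurable (A i)) ->
  lebesgue_tuple n [set t | forall i, A i (tnth t i)] =
    (\prod_(i < n) lebesgue_measure (A i))%E.
Proof.
elim: n A => [|n IH] A mA.
  by rewrite big_ord0 /= diracE mem_set//= => -[].
have mB : measurable [set t : n.-tuple R | forall i, A (lift ord0 i) (tnth t i)].
  rewrite (_ : [set _ | _] =
      \bigcap_(i in [set: 'I_n]) [set t | A (lift ord0 i) (tnth t i)]).
    apply: fin_bigcap_measurable => // i _.
    by rewrite -[X in measurable X]setTI; exact: measurable_tnth.
  by apply/seteqP; split => t /= h i; [move=> _|]; exact: h.
rewrite big_ord_recl -IH// /= /lebesgue_step /pushforward -product_measure1E//;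
  last exact: (mA ord0).
congr (product_measure1 _ _ _); apply/seteqP; split => -[x t] /=.
  by move=> h; split => [|i]; [exact: (h ord0)|have := h (lift ord0 i); rewrite tnthS].
by move=> [Ax At] i; have [j ->|->//] := unliftP ord0 i; rewrite tnthS.
Qed.

End lebesgue_tuple.

Section torus.
Context {R : realType} (d : nat).

Definition enorm (x : d.-tuple R) : R := Num.sqrt (\sum_(i < d) tnth x i ^+ 2).

Definition torus : set (d.-tuple R) :=
  [set x | forall i, - 2^-1 < tnth x i <= 2^-1].

Definition torus_dist (x y : d.-tuple R) : R :=
  inf [set enorm [tuple tnth x i - tnth y i - (tnth z i)%:~R | i < d]
      | z in [set: d.-tuple int]].

(* As torus has volume 1, no normalization is needed. *)
Definition uniform_torus (A : set (d.-tuple R)) : \bar R :=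
  lebesgue_tuple d (A `&` torus).

Lemma lebesgue_tuple_torus : lebesgue_tuple d torus = 1%E.
Proof.
have -> : torus = [set t | forall i, (fun=> `]- 2^-1, 2^-1]%classic) i (tnth t i)].
  by apply/seteqP; split => t /= h i; have := h i; rewrite in_itv.
rewrite (@lebesgue_tuple_box R d (fun=> `]- 2^-1, 2^-1]%classic))// big1// => i _.
rewrite lebesgue_measure_itv/= lte_fin ifT; last by lra.
by rewrite -EFinB; congr EFin; lra.
Qed.

End torus.

Section independence.
Context {R : realType} {disp : measure_display} {Omega : measurableType disp}.
Variable P : probability Omega R.

Definition mutually_independent (I : choiceType) (J : set I)
    (F : I -> set_system Omega) :=
  forall B : {fset I}, [set` B] `<=` J ->
  forall A : I -> set Omega, (forall i, i \in B -> F i (A i)) ->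
    P (\bigcap_(i in [set` B]) A i) = (\prod_(i <- B) P (A i))%E.

Context {disp' : measure_display} {T : measurableType disp'}.

Definition sigma_RV (Y : Omega -> T) : set_system Omega :=
  preimage_set_system [set: Omega] Y measurable.

Definition independent_RVs (I : choiceType) (J : set I) (Y : I -> Omega -> T) :=
  mutually_independent J (fun i => sigma_RV (Y i)).

Definition sigma_RVs (I : Type) (J : set I) (Y : I -> Omega -> T) :
    set_system Omega :=
  <<s \bigcup_(i in J) sigma_RV (Y i) >>.

End independence.

(* Vertices are the indices 0, ..., N - 1 rather than the points X i, which    *)
(* makes no difference as long as these points are pairwise distinct. Only the *)
(* values U i j with i < j are used.                                           *)
Section random_connection_graph.
Context {R : realType} (d : nat).
Variables (g : R -> R) (X : nat -> d.-tuple R) (U : nat -> nat -> R).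
Variables (N : nat) (r : R).

Definition connected_lt (i j : nat) : bool :=
  (i < j)%N && (U i j <= g (torus_dist (X i) (X j) / r)).

Definition adjacent (i j : 'I_N) : bool := connected_lt i j || connected_lt j i.

Definition degree (i : 'I_N) : nat := #|[pred j | adjacent i j]|.

Definition num_degree_ge (k : R) : nat := #|[pred i | k <= (degree i)%:R]|.

End random_connection_graph.

Definition std_normal_cdf {R : realType} (x : R) : \bar R :=
  normal_prob 0 1 `]-oo, x]%classic.

(* Main.v *)
Require Import Defs.
From HB Require Import structures.
From mathcomp Require Import all_boot all_order all_algebra finmap.
From mathcomp Require Import all_classical all_reals all_analysis.
From mathcomp Require Import measurable_realfun ring lra.

Set Implicit Arguments.
Unset Strict Implicit.
Unset Printing Implicit Defensive.

Import Order.TTheory GRing.Theory Num.Theory.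
Import numFieldNormedType.Exports.

Local Open Scope classical_set_scope.
Local Open Scope ring_scope.

(** In the graph on a Poisson process of intensity n, a typical vertex has exactly
    a Poisson number of neighbours. Indeed, fix a vertex and the number M + 1 of
    points. By the homogeneity of the torus, it is joined to any other point with a
    probability p that does not depend on its position ([connection_set_law]), so
    the events of being joined to the other points are independent although they
    share this vertex ([star_independence]), and the degree is binomial with
    parameters M and p. Averaging over the Poisson number of points, with the
    Poisson thinning identity ([poisson_thinning]), shows that the expected
    proportion of vertices of degree at least k is the probability that a Poisson
    variable of mean n p is at least k ([expected_num_degree_ge]).

    Scaling identifies n p with gamma log n times the fraction of the integral of
    g(|x|) that comes from a cube whose side is of order (n / log n)^(1/d). Outside
    the cube, g(|x|) is at most a constant times the product of the
    (1 + |x i|)^(-c/d), and c/d > 1, so the missing fraction is a negative power of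
    n up to logarithms. Hence n p = gamma log n + o(1) ([mean_degree_cvg]).

    It remains to know that a Poisson variable whose mean a + o(1) tends to infinity
    is at least a + delta sqrt a with a probability that tends to 1 - Phi(delta)
    ([poisson_upper_tail_cvg]). A Poisson variable of mean t is at most m with the
    probability that a Gamma variable of shape m + 1 exceeds t, which is an
    integral of t^m exp(-t) / m!. Centred at m and scaled by sqrt m, this integrand
    converges to a Gaussian up to a factor, under an integrable bound, and the
    factor is found by applying the same convergence to the total integral
    ([poisson_cdf_clt]). *)

(** * Bounds for the logarithm *)

Section log_bounds.
Context {R : realType}.
Implicit Types u s : R.

Let d1D u : is_derive u 1 (+%R (1 : R)) 1.
Proof.
have -> : +%R 1 = cst 1 + (@id R) by [].
by rewrite -[X in is_derive _ _ _ X]add0r; exact: is_deriveD.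
Qed.

Let d_phi u : -1 < u -> is_derive u 1 (fun x : R => ln (1 + x) - x + x ^+ 2 / 2)
  (u ^+ 2 / (1 + u)).
Proof.
move=> u1; have u0 : 0 < 1 + u by lra.
have h : is_derive u 1 (fun x : R => ln (1 + x)) ((1 + u)^-1).
  rewrite -[X in is_derive _ _ _ X]mulr1.
  apply: (@is_derive1_comp R (@ln R) (fun x => 1 + x)); first exact: is_derive1_ln.
  exact: d1D.
apply: is_derive_eq.
rewrite /GRing.scale /=; field; lra.
Qed.

Let d_psi u : -1 < u ->
  is_derive u 1 (fun x : R => x - x ^+ 2 / 2 * (1 + x)^-1 - ln (1 + x))
  (u ^+ 2 / (1 + u) ^+ 2 / 2).
Proof.
move=> u1; have u0 : 0 < 1 + u by lra.
have h : is_derive u 1 (fun x : R => ln (1 + x)) ((1 + u)^-1).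
  rewrite -[X in is_derive _ _ _ X]mulr1.
  apply: (@is_derive1_comp R (@ln R) (fun x => 1 + x)); first exact: is_derive1_ln.
  exact: d1D.
have h2 : is_derive u 1 (fun x : R => (1 + x)^-1) (- (1 + u) ^- 2 *: 1).
  apply: (@is_deriveV R (fun x => 1 + x) u 1 1); first by lra.
  exact: d1D.
apply: is_derive_eq.
rewrite /GRing.scale /=; field; lra.
Qed.

Let incr (f df : R -> R) u v : -1 < u -> u <= v ->
  (forall x : R, -1 < x -> is_derive x 1 f (df x)) ->
  (forall x, -1 < x -> 0 <= df x) -> f u <= f v.
Proof.
move=> u1 uv df_ df0.
have [||c] := @MVT_segment R f df u v uv.
- by move=> x; rewrite in_itv/= => /andP[ux _]; apply: df_; lra.
- apply: derivable_within_continuous => x; rewrite in_itv/= => /andP[ux _].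
  by have [] := df_ x ltac:(lra).
rewrite in_itv/= => /andP[uc _] e.
by rewrite -subr_ge0 e mulr_ge0 ?subr_ge0// df0//; lra.
Qed.

(** Both differences vanish at 0 and are non-decreasing on ]-1, +oo[, as their
    derivatives are u^2 / (1 + u) and u^2 / (2 (1 + u)^2). *)
Lemma ln1D_bounds u : -1 < u ->
  (0 <= u -> u - u ^+ 2 / 2 <= ln (1 + u) <= u - u ^+ 2 / 2 * (1 + u)^-1) /\
  (u <= 0 -> u - u ^+ 2 / 2 * (1 + u)^-1 <= ln (1 + u) <= u - u ^+ 2 / 2).
Proof.
move=> u1.
have p1 x : -1 < x -> 0 <= x ^+ 2 / (1 + x) :> R.
  by move=> x1; rewrite divr_ge0 ?sqr_ge0//; lra.
have p2 x : -1 < x -> 0 <= x ^+ 2 / (1 + x) ^+ 2 / 2 :> R.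
  by move=> x1; rewrite !divr_ge0 ?sqr_ge0.
have N10 : -1 < 0 :> R by lra.
split=> u0.
  have := incr N10 u0 d_phi p1; have := incr N10 u0 d_psi p2.
  rewrite !addr0 ln1 expr0n /=; lra.
have := incr u1 u0 d_phi p1; have := incr u1 u0 d_psi p2.
rewrite !addr0 ln1 expr0n /=; lra.
Qed.

End log_bounds.

(** * The Gamma-Poisson duality *)

Section poisson_gamma.
Context {R : realType}.
Implicit Types (t s a : R) (m : nat).

Definition poisson_cdf m t : R :=
  \sum_(l < m.+1) t ^+ l / l`!%:R * expR (- t).

Lemma poisson_cdf0 m : poisson_cdf m 0 = 1.
Proof.
rewrite /poisson_cdf big_ord_recl /= oppr0 expR0 expr0 fact0 divr1 mulr1.
by rewrite big1 ?addr0// => i _; rewrite /bump /= add1n exprS !mul0r.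
Qed.

(** The derivative of the sum telescopes. Together with the limit 0 at infinity
    this says that a Poisson variable of mean t is at most m with the probability
    that a Gamma variable of shape m + 1 exceeds t. *)
Lemma is_derive_poisson_cdf m t :
  is_derive t 1 (poisson_cdf m) (- (t ^+ m / m`!%:R * expR (- t))).
Proof.
have dE : is_derive t 1 (fun x : R => expR (- x)) (- expR (- t)).
  rewrite -[X in is_derive _ _ _ X]mulrN1.
  exact: (@is_derive1_comp R (@expR R) -%R).
elim: m => [|m IH].
  have -> : poisson_cdf 0 = fun x => expR (- x).
    apply/funext => x.
    by rewrite /poisson_cdf big_ord1 expr0 fact0 divr1 mul1r.
  by rewrite expr0 fact0 divr1 mul1r.
have -> : poisson_cdf m.+1 = poisson_cdf m +
    (m.+1`!%:R^-1 \*: ((@id R) ^+ m.+1 * (fun x => expR (- x)))).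
  apply/funext => x; rewrite /poisson_cdf big_ord_recr /=; congr (_ + _).
  by rewrite fctE /= /GRing.scale /= exprfctE; ring.
apply: is_derive_eq.
rewrite /GRing.scale /= exprfctE factS natrM exprS mulr1.
have h1 : (m`!%:R : R) != 0 by rewrite pnatr_eq0 -lt0n fact_gt0.
have h2 : (1 + m%:R : R) != 0 by rewrite nat1r pnatr_eq0.
by field; rewrite h1 h2.
Qed.

Lemma poisson_cdf_cvg0 m : poisson_cdf m t @[t --> +oo] --> (0 : R).
Proof.
apply: (@squeeze_cvgr _ _ _ _ (fun=> 0)
  (fun t => (\sum_(l < m.+1) l.+1%:R) * t^-1)).
- near=> t; have t0 : 0 < t by [].
  rewrite sumr_ge0/=; last first.
    by move=> l _; rewrite mulr_ge0 ?expR_ge0 ?divr_ge0 ?exprn_ge0 ?ltW.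
  rewrite mulr_suml; apply: ler_sum => l _.
  rewrite expRN ler_pdivrMr ?expR_gt0//.
  (* compare with the single term of index l + 1 of the exponential series *)
  apply: le_trans (_ : l.+1%:R * t^-1 * (t ^+ l.+1 / l.+1`!%:R) <= _).
    rewrite factS natrM exprS le_eqVlt; apply/orP; left; apply/eqP; field.
    by rewrite nat1r !pnatr_eq0 -lt0n fact_gt0 (gt_eqF t0).
  rewrite ler_wpM2l//; first by rewrite divr_ge0// ltW.
  by have := expR_ge1Dxn l (ltW t0); lra.
- exact: cvg_cst.
- rewrite -[X in _ --> X](mulr0 (\sum_(l < m.+1) l.+1%:R)).
  apply: cvgMr; apply/gtr0_cvgV0; last exact: cvg_id.
  exact: nbhs_pinfty_gt.
Unshelve. all: by end_near. Qed.

End poisson_gamma.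

Section gamma_kernel.
Context {R : realType}.
Implicit Types (t s a : R) (m : nat).
Local Notation mu := (@lebesgue_measure R).

(** The density of a Gamma variable of shape m + 1, centred at its mode m, scaled
    by sqrt m, and divided by its maximum. *)
Definition gamma_kernel m s : R :=
  (1 + s / Num.sqrt m%:R) ^+ m * expR (- (Num.sqrt m%:R * s)).

(** The maximum by which [gamma_kernel] is divided. *)
Definition gamma_const m : R :=
  Num.sqrt m%:R * m%:R ^+ m * expR (- m%:R) / m`!%:R.

Lemma gamma_const_gt0 m : (0 < m)%N -> 0 < gamma_const m.
Proof.
move=> m0; rewrite /gamma_const divr_gt0 ?ltr0n ?fact_gt0//.
by rewrite !mulr_gt0 ?expR_gt0 ?exprn_gt0 ?sqrtr_gt0 ?ltr0n.
Qed.

Lemma continuous_gamma_kernel m : continuous (gamma_kernel m).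
Proof.
move=> s; apply: (@continuousM _ _ (fun s => (1 + s / Num.sqrt m%:R) ^+ m)
  (fun s => expR (- (Num.sqrt m%:R * s)))).
  apply: (@continuous_comp _ _ _ (fun s => 1 + s / Num.sqrt m%:R)
    (fun x : R => x ^+ m)); last exact: exprn_continuous.
  apply: cvgD; first exact: cvg_cst.
  by apply: cvgMl; exact: cvg_id.
apply: (@continuous_comp _ _ _ (fun s => - (Num.sqrt m%:R * s)) (@expR R)).
  by apply: cvgN; apply: cvgMr; exact: cvg_id.
exact: continuous_expR.
Qed.

Lemma gamma_kernel_ge0 m s : (0 < m)%N -> - Num.sqrt m%:R <= s ->
  0 <= gamma_kernel m s.
Proof.
move=> m0 ms; rewrite mulr_ge0 ?expR_ge0// exprn_ge0//.
have q0 : 0 < Num.sqrt m%:R :> R by rewrite sqrtr_gt0 ltr0n.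
by rewrite -lerBlDl sub0r ler_pdivlMr// mulN1r.
Qed.

(** The Gamma-Poisson duality, read after centring and scaling: up to the factor
    [- gamma_const m], the kernel is the derivative of the distribution function
    in the substituted mean m + sqrt m * s. *)
Lemma integral_gamma_kernel m a : (0 < m)%N -> - Num.sqrt m%:R <= a ->
  (\int[mu]_(s in `[a, +oo[) (gamma_kernel m s)%:E =
   (poisson_cdf m (m%:R + Num.sqrt m%:R * a) / gamma_const m)%:E)%E.
Proof.
move=> m0 ma.
set q : R := Num.sqrt m%:R.
have q0 : 0 < q :> R by rewrite sqrtr_gt0 ltr0n.
have mq : m%:R = q ^+ 2 by rewrite sqr_sqrtr.
have c0 := gamma_const_gt0 m0.
pose G s : R := m%:R + q * s.
pose F s : R := - ((gamma_const m)^-1 * poisson_cdf m (G s)).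
have dG s : is_derive s 1 G (q).
  have := @is_deriveZ R R R (@id R) q s 1 1 (is_derive_id s 1).
  rewrite [_ *: _]mulr1 => h; have := is_deriveD (is_derive_cst (m%:R : R) s (1 : R)) h.
  by rewrite add0r.
have dF s : is_derive s 1 F (gamma_kernel m s).
  have h := @is_derive1_comp R (poisson_cdf m) G s _ _
    (is_derive_poisson_cdf m (G s)) (dG s).
  have : is_derive s 1 F (- ((gamma_const m)^-1 *
      (- (G s ^+ m / m`!%:R * expR (- G s)) * q))).
    exact: (@is_deriveN _ _ _ ((gamma_const m)^-1 \*: (poisson_cdf m \o G))).
  congr (is_derive _ _ _ _); rewrite /gamma_kernel /gamma_const -/q.
  have -> : G s = m%:R * (1 + s / q).
    by rewrite /G mq; field; exact: lt0r_neq0.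
  rewrite exprMn mulrDr mulr1 opprD expRD.
  have -> : m%:R * (s / q) = q * s.
    by rewrite mq; field; exact: lt0r_neq0.
  field; rewrite !pnatr_eq0 -lt0n fact_gt0 !lt0r_neq0 ?expR_gt0//=.
  by rewrite exprn_gt0// ltr0n.
rewrite (@ge0_continuous_FTC2y _ _ F _ 0).
- by rewrite sub0e /F EFinN oppeK mulrC.
- by move=> s /(le_trans ma); exact: gamma_kernel_ge0.
- by apply: continuous_subspaceT; exact: continuous_gamma_kernel.
- rewrite -oppr0 -[X in - X](mulr0 (gamma_const m)^-1).
  apply: cvgN; apply: cvgMr.
  apply: (@cvg_comp _ _ _ G (poisson_cdf m)); last exact: poisson_cdf_cvg0.
  apply: (@cvg_comp _ _ _ (fun s => q * s) (fun r => m%:R + r)).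
    by apply: gt0_cvgMry => //; exact: cvg_id.
  exact: cvg_addrl.
- by move=> s _; have [] := dF s.
- apply: cvg_at_right_filter; apply: differentiable_continuous.
  by apply/derivable1_diffP; have [] := dF a.
- by move=> s _; rewrite derive1E; exact: (@derive_val _ _ _ _ _ _ _ (dF s)).
Qed.

End gamma_kernel.

(** * The central limit theorem for Poisson variables *)

Section gamma_kernel_limit.
Context {R : realType}.
Implicit Types (s a : R) (m : nat).
Local Notation mu := (@lebesgue_measure R).

Lemma gamma_kernelE m s : (0 < m)%N -> - Num.sqrt m%:R < s ->
  gamma_kernel m s =
  expR (m%:R * (ln (1 + s / Num.sqrt m%:R) - s / Num.sqrt m%:R)).
Proof.
move=> m0 ms; set q : R := Num.sqrt m%:R.
have q0 : 0 < q :> R by rewrite sqrtr_gt0 ltr0n.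
have mq : m%:R = q ^+ 2 by rewrite sqr_sqrtr.
have u0 : 0 < 1 + s / q by rewrite -ltrBlDl sub0r ltr_pdivlMr// mulN1r.
rewrite mulrBr expRD mulrC -[X in _ * X]/(expR _) expRM_natl lnK ?posrE//.
rewrite /gamma_kernel -/q [LHS]mulrC; congr (expR _ * _).
by rewrite mq; field; exact: lt0r_neq0.
Qed.

(** The first bound gives the pointwise convergence of [gamma_kernel] to the
    Gaussian, the second one an integrable dominating function that is the same
    for all m. As sqrt m is at least 1, s / sqrt m is at most s for s >= 0, so the
    logarithmic bound gives e <= - s^2 / (2 (1 + s)) <= (1 - s) / 2; for s <= 0 it
    gives e <= - s^2 / 2. *)
Lemma gamma_exponent_bounds m s (q : R) : (0 < m)%N -> q = Num.sqrt m%:R ->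
  - q < s ->
  let e := m%:R * (ln (1 + s / q) - s / q) in
  `|e + s ^+ 2 / 2| <= `|s ^+ 2 / 2 * (1 - (1 + s / q)^-1)| /\
  e <= (1 - `|s|) / 2.
Proof.
move=> m0 qE ms.
have q1 : 1 <= q by rewrite qE -[X in X <= _]sqrtr1 ler_sqrt// ler1n.
have q0 : 0 < q by lra.
have mq : m%:R = q ^+ 2 by rewrite qE sqr_sqrtr.
have u1 : -1 < s / q by rewrite ltr_pdivlMr// mulN1r.
have [hp hn] := ln1D_bounds u1.
have sE : s = s / q * q by rewrite divfK// lt0r_neq0.
set u := s / q in u1 hp hn sE *; move=> e.
have mE (y z : R) : m%:R * (y ^+ 2 / 2 * z) = (y * q) ^+ 2 / 2 * z.
  by rewrite mq; ring.
have m0' : 0 <= m%:R :> R by [].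
have [u0|u0] := leP 0 u.
- have /andP[/(ler_wpM2l m0') l1 /(ler_wpM2l m0') l2] := hp u0.
  have {}l1 : - (s ^+ 2 / 2) <= e.
    by move: l1 (mE u 1); rewrite /e -sE !mulrBr !mulr1; lra.
  have {}l2 : e <= - (s ^+ 2 / 2 * (1 + u)^-1).
    by move: l2 (mE u (1 + u)^-1); rewrite /e -sE !mulrBr; lra.
  have s0 : 0 <= s by rewrite sE mulr_ge0// ltW.
  split.
    rewrite !ger0_norm; first lra; last lra.
    rewrite mulr_ge0 ?divr_ge0 ?sqr_ge0// subr_ge0 invf_le1; lra.
  apply: (le_trans l2); rewrite ger0_norm//.
  have us : u <= s by rewrite ler_pdivrMr// ler_peMr.
  have : (1 + s)^-1 <= (1 + u)^-1 by rewrite lef_pV2 ?posrE; lra.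
  have h : (s ^+ 2) / 2 * (1 + s)^-1 >= (s - 1) / 2.
    rewrite ler_pdivlMr; nra.
  have : 0 <= s ^+ 2 / 2 by rewrite divr_ge0 ?sqr_ge0.
  nra.
- have /andP[/(ler_wpM2l m0') l1 /(ler_wpM2l m0') l2] := hn (ltW u0).
  have {}l1 : - (s ^+ 2 / 2 * (1 + u)^-1) <= e.
    by move: l1 (mE u (1 + u)^-1); rewrite /e -sE !mulrBr; lra.
  have {}l2 : e <= - (s ^+ 2 / 2).
    by move: l2 (mE u 1); rewrite /e -sE !mulrBr !mulr1; lra.
  have s0 : s <= 0 by rewrite sE nmulr_rle0 // ltW.
  have v1 : 1 <= (1 + u)^-1 by rewrite invf_ge1; lra.
  split.
    rewrite ler0_norm; last by lra.
    rewrite ler0_norm; first lra.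
    by rewrite mulr_ge0_le0 ?divr_ge0 ?sqr_ge0//; lra.
  apply: (le_trans l2); rewrite ler0_norm//; nra.
Qed.

End gamma_kernel_limit.

Section gamma_kernel_dct.
Context {R : realType}.
Implicit Types (s a : R) (m : nat).
Local Notation mu := (@lebesgue_measure R).

Lemma gamma_kernel_cvg (mn : nat -> nat) s : (forall n, 0 < mn n)%N ->
  (Num.sqrt (mn n)%:R : R) @[n --> \oo] --> +oo ->
  gamma_kernel (mn n) s @[n --> \oo] --> normal_fun 0 1 s.
Proof.
move=> m0 qoo.
pose e n : R := (mn n)%:R *
  (ln (1 + s / Num.sqrt (mn n)%:R) - s / Num.sqrt (mn n)%:R).
have ms : \forall n \near \oo, - Num.sqrt (mn n)%:R < s.
  near=> n; rewrite ltrNl; near: n; exact: (cvgryPgt _).1.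
have -> : normal_fun 0 1 s = expR (- (s ^+ 2 / 2)).
  by rewrite /normal_fun subr0 expr1n mulNr.
apply: (@cvg_trans _ (expR (e n) @[n --> \oo])).
  by apply: near_eq_cvg; near=> n; rewrite gamma_kernelE//; near: n.
apply: (@cvg_comp _ _ _ e (@expR R)); last exact: continuous_expR.
rewrite -(add0r (- (s ^+ 2 / 2))).
have -> : e = (fun n => (e n + s ^+ 2 / 2) + - (s ^+ 2 / 2)).
  by apply/funext => n; rewrite addrK.
apply: cvgD; last exact: cvg_cst.
have z : (s ^+ 2 / 2 * (1 - (1 + s / Num.sqrt (mn n)%:R)^-1)) @[n --> \oo] --> (0 : R).
  rewrite -[X in _ --> X](mulr0 (s ^+ 2 / 2)); apply: cvgMr.
  rewrite -[X in _ --> X](subrr 1); apply: cvgB; first exact: cvg_cst.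
  rewrite -[X in _ --> X]invr1; apply: cvgV => //.
  rewrite -[X in _ --> X]addr0; apply: cvgD; first exact: cvg_cst.
  rewrite -[X in _ --> X](mulr0 s); apply: cvgMr.
  by apply/gtr0_cvgV0 => //; near=> n; rewrite sqrtr_gt0 ltr0n.
apply/norm_cvg0P.
apply: (@squeeze_cvgr _ _ _ _ (fun=> 0)
  (fun n => `|s ^+ 2 / 2 * (1 - (1 + s / Num.sqrt (mn n)%:R)^-1)|)).
- near=> n; rewrite normr_ge0/=.
  have msn : - Num.sqrt (mn n)%:R < s by near: n.
  by have [] := gamma_exponent_bounds (m0 n) erefl msn.
- exact: cvg_cst.
- exact/norm_cvg0P.
Unshelve. all: by end_near. Qed.

Lemma gamma_kernel_le m s : (0 < m)%N -> - Num.sqrt m%:R <= s ->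
  gamma_kernel m s <= expR ((1 - `|s|) / 2).
Proof.
move=> m0; rewrite le_eqVlt => /predU1P[<-|ms].
  rewrite /gamma_kernel mulNr divff ?subrr ?expr0n ?gtn_eqF// ?mul0r ?expR_ge0//.
  by rewrite gt_eqF ?sqrtr_gt0 ?ltr0n.
rewrite gamma_kernelE// ler_expR.
by have [] := gamma_exponent_bounds m0 erefl ms.
Qed.

Lemma integrable_expR_norm :
  mu.-integrable setT (EFin \o (fun s : R => expR ((1 - `|s|) / 2))).
Proof.
have ch : continuous (fun s : R => (1 - `|s|) / 2).
  move=> s; apply: cvgMl; apply: cvgB; first exact: cvg_cst.
  exact: norm_continuous.
have cH : continuous (fun s : R => expR ((1 - `|s|) / 2)).
  move=> s; apply: (@continuous_comp _ _ _ (fun s : R => (1 - `|s|) / 2) (@expR R)).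
    exact: ch.
  exact: continuous_expR.
have mH : measurable_fun setT (fun s : R => expR ((1 - `|s|) / 2)).
  exact: continuous_measurable_fun cH.
apply/integrableP; split; first exact/measurable_EFinP.
under eq_integral do rewrite /= ger0_norm ?expR_ge0//.
rewrite ge0_symfun_integralT//; last by move=> s /=; rewrite normrN.
rewrite -set_itvcy.
have -> : (\int[mu]_(s in `[0%R, +oo[) (expR ((1 - `|s|) / 2))%:E =
           \int[mu]_(s in `[0%R, +oo[) (expR ((1 - s) / 2))%:E)%E.
  apply: eq_integral => s; rewrite inE/= in_itv/= andbT => s0.
  by rewrite ger0_norm.
pose F (s : R) : R := (-2) * expR ((1 - s) / 2).
have dF (s : R) : is_derive s 1 F (expR ((1 - s) / 2)).
  have h1 : is_derive s 1 (fun s : R => (1 - s) / 2) (- 2^-1).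
    have := is_deriveB (is_derive_cst (1 : R) s (1 : R)) (is_derive_id s (1 : R)).
    move=> /(@is_deriveZ R R R _ 2^-1 s 1 _).
    rewrite sub0r [X in is_derive _ _ _ X]mulrN1.
    by congr is_derive; apply/funext => y; rewrite [LHS]mulrC.
  have := @is_derive1_comp R (@expR R) (fun s => (1 - s) / 2) s _ _ _ h1.
  move=> /(_ _ (is_derive_expR _)) /(@is_deriveZ R R R _ (-2) s 1 _).
  by congr is_derive; rewrite /GRing.scale /=; field.
rewrite (@ge0_continuous_FTC2y _ _ F _ 0).
- by rewrite -EFinD -EFinM ltry.
- by move=> s _; exact: expR_ge0.
- apply: continuous_subspaceT => s.
  apply: (@continuous_comp _ _ _ (fun s => (1 - s) / 2) (@expR R)).
    by apply: cvgMl; apply: cvgB; [exact: cvg_cst|exact: cvg_id].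
  exact: continuous_expR.
- rewrite -[X in _ --> X](mulr0 (-2)); apply: cvgMr.
  have -> : (fun s : R => expR ((1 - s) / 2)) =
     (fun s => expR 2^-1 * expR (- (2^-1 * s))).
    by apply/funext => s; rewrite -expRD; congr expR; lra.
  rewrite -[X in _ --> X](mulr0 (expR 2^-1)); apply: cvgMr.
  apply: (@cvg_comp _ _ _ (fun s => 2^-1 * s) (fun y => expR (- y))).
    by apply: gt0_cvgMry => //; exact: cvg_id.
  exact: cvgr_expR.
- by move=> s _; have [] := dF s.
- apply: cvg_at_right_filter; apply: differentiable_continuous.
  by apply/derivable1_diffP; have [] := dF 0.
- by move=> s _; rewrite derive1E; exact: (@derive_val _ _ _ _ _ _ _ (dF s)).
Qed.

End gamma_kernel_dct.

Section poisson_clt.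
Context {R : realType}.
Implicit Types (s a : R) (m : nat).
Local Notation mu := (@lebesgue_measure R).

(** Dominated convergence. The domains of integration converge to D except at x0,
    which is a null set. *)
Lemma integral_gamma_kernel_cvg (mn : nat -> nat) (an : nat -> R) (D : set R)
    (x0 : R) :
  (forall n, 0 < mn n)%N ->
  (Num.sqrt (mn n)%:R : R) @[n --> \oo] --> +oo ->
  (forall n, - Num.sqrt (mn n)%:R <= an n) ->
  measurable D ->
  (forall s, s != x0 -> \forall n \near \oo, (an n <= s) = (s \in D)) ->
  (\int[mu]_(s in `[an n, +oo[) (gamma_kernel (mn n) s)%:E)%E @[n --> \oo] -->
  (\int[mu]_(s in D) (normal_fun 0 1 s)%:E)%E.
Proof.
move=> m0 qoo man mD anD.
pose f n : R -> \bar R := (EFin \o gamma_kernel (mn n)) \_ `[an n, +oo[.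
pose f0 : R -> \bar R := (EFin \o normal_fun 0 1) \_ D.
have mf n : measurable_fun setT (f n).
  apply/(measurable_restrictT _ _).1 => //.
  apply: measurable_funTS; apply/measurable_EFinP.
  apply: continuous_measurable_fun; exact: continuous_gamma_kernel.
have mf0 : measurable_fun setT f0.
  apply/(measurable_restrictT _ _).1 => //.
  apply: measurable_funTS; apply/measurable_EFinP; exact: measurable_normal_fun.
have [] := @dominated_convergence _ _ _ mu setT measurableT f f0
  (EFin \o (fun s : R => expR ((1 - `|s|) / 2))) mf mf0 _ integrable_expR_norm _.
- exists [set x0]; split; [exact: measurable_set1|exact: lebesgue_measure_set1|].
  move=> s /= h; apply: contrapT => /eqP sx; apply: h => _.
  apply: (@cvg_trans _ (((if s \in D then gamma_kernel (mn n) s else 0)%:E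
     @[n --> \oo]))).
    apply: near_eq_cvg; near=> n.
    rewrite /f patchE mem_setE in_itv/= andbT.
    have -> : (an n <= s) = (s \in D) by near: n; exact: anD.
    by case: ifP.
  rewrite /f0 patchE; case: ifP => sD; last exact: cvg_cst.
  by apply: cvg_EFin; [exact: nearW|exact: gamma_kernel_cvg].
- apply: aeW => s n _; rewrite /f patchE mem_setE in_itv/= andbT.
  case: ifP => [as_|_]; last by rewrite abse0 lee_fin expR_ge0.
  have ms : - Num.sqrt (mn n)%:R <= s by rewrite (le_trans (man n)).
  by rewrite lee_fin ger0_norm ?gamma_kernel_le// gamma_kernel_ge0.
rewrite /f0 -integral_mkcond.
have -> : (fun n => \int[mu]_(s in `[an n, +oo[) (gamma_kernel (mn n) s)%:E)%E =
  (fun n => \int[mu]_s f n s)%E.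
  by apply/funext => n; rewrite [LHS]integral_mkcond.
by [].
Unshelve. all: by end_near. Qed.

Lemma integral_normal_fun (D : set R) : measurable D ->
  (\int[mu]_(s in D) (normal_pdf 0 1 s)%:E =
   (normal_peak 1)%:E * \int[mu]_(s in D) (normal_fun 0 1 s)%:E)%E.
Proof.
move=> mD; rewrite normal_pdfE ?oner_eq0//.
under eq_integral do rewrite EFinM.
rewrite ge0_integralZl//.
- by apply: measurable_funTS; apply/measurable_EFinP; exact: measurable_normal_fun.
- by move=> x _; rewrite lee_fin normal_fun_ge0.
- by rewrite lee_fin normal_peak_ge0.
Qed.

(** The threshold and the mean vary together. The distribution function is the
    integral of [gamma_kernel] over a half-line divided by the integral over the
    half-line that starts at - sqrt m, because the mean 0 gives the value 1; the
    ratio removes [gamma_const]. Both integrals converge to Gaussian integrals. *)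
Lemma poisson_cdf_clt (mn : nat -> nat) (lam : nat -> R) (x : R) :
  (forall n, 0 < mn n)%N -> (forall n, 0 <= lam n) ->
  (Num.sqrt (mn n)%:R : R) @[n --> \oo] --> +oo ->
  (lam n - (mn n)%:R) / Num.sqrt (mn n)%:R @[n --> \oo] --> x ->
  (poisson_cdf (mn n) (lam n))%:E @[n --> \oo] -->
  normal_prob 0 1 `[x, +oo[.
Proof.
move=> m0 l0 qoo lamx.
have q0 n : 0 < Num.sqrt (mn n)%:R :> R by rewrite sqrtr_gt0 ltr0n.
have q2 n : (mn n)%:R = Num.sqrt (mn n)%:R ^+ 2 :> R by rewrite sqr_sqrtr.
pose an n : R := (lam n - (mn n)%:R) / Num.sqrt (mn n)%:R.
have man n : - Num.sqrt (mn n)%:R <= an n.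
  rewrite /an ler_pdivlMr// mulNr -expr2 -q2; have := l0 n; lra.
have num : (\int[mu]_(s in `[an n, +oo[) (gamma_kernel (mn n) s)%:E)%E
   @[n --> \oo] --> (\int[mu]_(s in `[x, +oo[) (normal_fun 0 1 s)%:E)%E.
  apply: (@integral_gamma_kernel_cvg _ _ _ x) => // s; rewrite neq_lt.
  rewrite mem_setE in_itv/= andbT => /orP[sx|xs]; near=> n.
    rewrite (leNgt x) sx leNgt; apply/negbTE; rewrite negbK.
    by near: n; exact: cvgr_gt lamx _ sx.
  by rewrite (ltW xs); apply/ltW; near: n; exact: cvgr_lt lamx _ xs.
(* the starting point - sqrt m corresponds to a Poisson variable of mean 0 *)
have den : (\int[mu]_(s in `[(- Num.sqrt (mn n)%:R)%R, +oo[)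
     (gamma_kernel (mn n) s)%:E)%E @[n --> \oo]
   --> (\int[mu]_s (normal_fun 0 1 s)%:E)%E.
  apply: (@integral_gamma_kernel_cvg _ _ _ x) => // s _; near=> n.
  rewrite in_setT lerNl; near: n; exact: (cvgryPge _).1.
have mN D : measurable D -> measurable_fun D (fun s => (normal_fun 0 1 s)%:E : \bar R).
  by move=> mD; apply: measurable_funTS; apply/measurable_EFinP;
     exact: measurable_normal_fun.
have p0 : 0 < normal_peak 1 :> R by rewrite normal_peak_gt0 ?oner_eq0.
have B1 : (\int[mu]_s (normal_fun 0 1 s)%:E = (normal_peak 1)^-1%:E)%E.
  have := integral_normal_pdf (0 : R) 1; rewrite integral_normal_fun//.
  move/(congr1 (fun z => (normal_peak 1)^-1%:E * z)%E).
  by rewrite muleA -EFinM mulVf ?lt0r_neq0// mul1e mule1.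
have Afin : (\int[mu]_(s in `[x, +oo[) (normal_fun 0 1 s)%:E)%E \is a fin_num.
  rewrite ge0_fin_numE; last first.
    by apply: integral_ge0 => s _; rewrite lee_fin normal_fun_ge0.
  apply: (@le_lt_trans _ _ (\int[mu]_s (normal_fun 0 1 s)%:E)%E).
    apply: ge0_subset_integral => //; first exact: mN.
    by move=> s _; rewrite lee_fin normal_fun_ge0.
  by rewrite B1 ltry.
rewrite /normal_prob integral_normal_fun// -(fineK Afin) -EFinM.
apply: cvg_EFin; first exact: nearW.
move: num; rewrite -(fineK Afin) => /fine_cvg num.
move: den; rewrite B1 => /fine_cvg den.
have -> : (fine \o (fun n => (poisson_cdf (mn n) (lam n))%:E)) =
  (fun n => fine (\int[mu]_(s in `[an n, +oo[) (gamma_kernel (mn n) s)%:E)%E /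
   fine (\int[mu]_(s in `[(- Num.sqrt (mn n)%:R)%R, +oo[)
     (gamma_kernel (mn n) s)%:E)%E).
  apply/funext => n /=; rewrite !integral_gamma_kernel//=.
  rewrite mulrN -expr2 -q2 subrr poisson_cdf0.
  have -> : (mn n)%:R + Num.sqrt (mn n)%:R * an n = lam n.
    by rewrite /an mulrC divfK ?lt0r_neq0//; lra.
  by rewrite mul1r invrK divfK// lt0r_neq0// gamma_const_gt0.
rewrite mulrC -[X in _ * X]invrK; apply: cvgM => //; apply: cvgV => //.
by rewrite invr_neq0// lt0r_neq0.
Unshelve. all: by end_near. Qed.

Lemma normal_prob_sym (x : R) :
  normal_prob 0 1 `[- x, +oo[ = std_normal_cdf x.
Proof.
rewrite /std_normal_cdf /normal_prob.
rewrite -[in RHS](opprK x) ge0_integration_by_substitutionNy.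
- apply: eq_integral => s _ /=; congr EFin.
  by rewrite normal_pdfE ?oner_eq0// /normal_fun !subr0 sqrrN.
- by apply: continuous_subspaceT; apply: continuous_normal_pdf; exact: oner_neq0.
- by move=> s _; exact: normal_pdf_ge0.
Qed.

End poisson_clt.

(** * Independence around the centre of a star *)

Section product_law.
Context {R : realType}.

Lemma finite_product_measure_ext d1 d2 (T1 : measurableType d1)
    (T2 : measurableType d2) (m1 m2 : {measure set (T1 * T2) -> \bar R}) :
  (m1 setT < +oo)%E ->
  (forall A B, measurable A -> measurable B -> m1 (A `*` B) = m2 (A `*` B)) ->
  forall X, measurable X -> m1 X = m2 X.
Proof.
move=> m1oo m12 X mX.
pose G : set (set (T1 * T2)) := [set A `*` B | A in measurable & B in measurable].
apply: (measure_unique G (fun=> setT)) => //.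
- by rewrite measurable_prod_measurableType.
- move=> _ _ [A1 mA1 [B1 mB1 <-]] [A2 mA2 [B2 mB2 <-]].
  rewrite -setXI; exists (A1 `&` A2); first exact: measurableI.
  by exists (B1 `&` B2) => //; exact: measurableI.
- by move=> _; exists setT => //; exists setT => //; rewrite setXTT.
- by rewrite bigcup_const//; exists 0%N.
- by move=> _ [A mA [B mB <-]]; exact: m12.
Qed.

Context {disp : measure_display} {Omega : measurableType disp}.
Variable P : probability Omega R.

(** On the event G, the pair (W1, W2) has the law m1 x m2 with total mass x; it is
    enough to compare the two measures on boxes, which generate the product
    sigma-algebra. *)
Lemma joint_law_product d1 d2 (T1 : measurableType d1) (T2 : measurableType d2)
    (m1 : probability T1 R) (m2 : probability T2 R)
    (W1 : Omega -> T1) (W2 : Omega -> T2) (G : set Omega) (x : R) :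
  measurable_fun setT W1 -> measurable_fun setT W2 -> measurable G ->
  (forall A B, measurable A -> measurable B ->
    P (G `&` (W1 @^-1` A `&` W2 @^-1` B)) = (x%:E * (m1 A * m2 B))%E) ->
  forall D, measurable D ->
    P (G `&` [set w | D (W1 w, W2 w)]) = (x%:E * (m1 \x m2) D)%E.
Proof.
move=> mW1 mW2 mG PG D mD.
have x0 : 0 <= x.
  have := PG setT setT measurableT measurableT.
  by rewrite !probability_setT !mule1 -lee_fin => <-.
have mW : measurable_fun setT (fun w => (W1 w, W2 w)).
  exact: measurable_fun_pair.
have h := @finite_product_measure_ext _ _ _ _
  (pushforward (mrestr P mG) (fun w => (W1 w, W2 w)))
  (mscale (NngNum x0) (m1 \x m2)%E) .
rewrite setIC; apply: (h mW) => //.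
  rewrite /= /pushforward /mrestr [X in P X](_ : _ = G).
    by rewrite (le_lt_trans (probability_le1 P mG)) ?ltry.
  by apply/seteqP; split => w //= [].
move=> A B mA mB; rewrite /= /mscale/= product_measure1E// -PG// setIC.
by congr (P (_ `&` _)); apply/seteqP; split.
Qed.

End product_law.

Section star_independence.
Context {R : realType} {disp : measure_display} {Omega : measurableType disp}.
Variable P : probability Omega R.
Context {dT dV : measure_display} {T : measurableType dT} {V : measurableType dV}.
Variables (mu : probability T R) (nu : probability V R).
Variables (Z : Omega -> T) (X : nat -> Omega -> T) (Y : nat -> Omega -> V).
Variables (H : set Omega) (J : pred nat).
Hypotheses (mZ : measurable_fun setT Z)
  (mX : forall j, measurable_fun setT (X j))
  (mY : forall j, measurable_fun setT (Y j)) (mH : measurable H).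

Let box (s : seq nat) (A : nat -> set T) (B : nat -> set V) : set Omega :=
  \big[setI/setT]_(j <- s) (X j @^-1` A j `&` Y j @^-1` B j).

Hypothesis indep : forall (s : seq nat) (C : set T) (A : nat -> set T)
    (B : nat -> set V), uniq s -> all J s ->
  measurable C -> (forall j, measurable (A j)) -> (forall j, measurable (B j)) ->
  P (H `&` Z @^-1` C `&` box s A B) =
    (P H * mu C * \prod_(j <- s) (mu (A j) * nu (B j)))%E.

Variables (D : nat -> set (T * T * V)) (q : nat -> R).
Hypotheses (mD : forall j, measurable (D j))
  (Dq : forall j C, measurable C ->
    ((mu \x mu) \x nu)%E (D j `&` [set p | C p.1.1]) = (mu C * (q j)%:E)%E).

Let E j : set Omega := [set w | D j ((Z w, X j w), Y j w)].

Let mpre d1 (S : measurableType d1) (f : Omega -> S) A :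
  measurable_fun setT f -> measurable A -> measurable (f @^-1` A).
Proof. by move=> mf mA; rewrite -[X in measurable X]setTI; exact: mf. Qed.

Let mE j : measurable (E j).
Proof.
apply: (@mpre _ _ (fun w => ((Z w, X j w), Y j w)) (D j)) => //.
by apply: measurable_fun_pair => //; exact: measurable_fun_pair.
Qed.

Let mbox s A B : (forall j, measurable (A j)) -> (forall j, measurable (B j)) ->
  measurable (box s A B).
Proof.
move=> mA mB; rewrite /box; elim/big_ind : _ => // [|i _].
  by move=> ? ? ? ?; exact: measurableI.
by apply: measurableI; exact: mpre.
Qed.

(** The induction converts the conditions on the leaves one at a time from
    coordinatewise conditions, which are independent by hypothesis, to the events
    E j. The event C on the centre has to stay in the statement, since the next
    leaf is converted by means of the joint law of (Z, X j, Y j). *)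
Let star_box (s1 s2 : seq nat) : uniq (s1 ++ s2) -> all J (s1 ++ s2) ->
  forall C A B, measurable C -> (forall j, measurable (A j)) ->
  (forall j, measurable (B j)) ->
  P (H `&` Z @^-1` C `&` \big[setI/setT]_(j <- s1) E j `&` box s2 A B) =
  (P H * mu C * (\prod_(j <- s1) q j)%:E *
     \prod_(j <- s2) (mu (A j) * nu (B j)))%E.
Proof.
elim: s1 s2 => [|j s1 IH] s2 us js C A B mC mA mB.
  by rewrite !big_nil setIT mule1; exact: indep.
have us' : uniq (s1 ++ j :: s2) by rewrite -cat1s uniq_catCA.
have js' : all J (s1 ++ j :: s2).
  by move: js; rewrite /= !all_cat /= => /and3P[-> -> ->].
have js2 : j \notin s2.
  by move: us; rewrite /= mem_cat negb_or => /andP[/andP[]].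
pose G : set Omega := H `&` \big[setI/setT]_(i <- s1) E i `&` box s2 A B.
have mG : measurable G.
  apply: measurableI; last exact: mbox.
  by apply: measurableI => //; exact: bigsetI_measurable.
pose x : \bar R := (P H * (\prod_(i <- s1) q i)%:E *
     \prod_(i <- s2) (mu (A i) * nu (B i)))%E.
have xfin : x \is a fin_num.
  rewrite !fin_numM ?fin_num_measure//.
  by rewrite big_seq; elim/big_ind : _ => // [a b|i _]; [exact: fin_numM|];
     rewrite fin_numM ?fin_num_measure.
(* the event G is independent of the triple (Z, X j, Y j), tested on boxes *)
have rect C' A' B' : measurable C' -> measurable A' -> measurable B' ->
    P (G `&` (Z @^-1` C' `&` X j @^-1` A' `&` Y j @^-1` B')) =
    (x * (mu C' * mu A' * nu B'))%E.
  move=> mC' mA' mB'.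
  pose A2 (l : nat) := if l == j then A' else A l.
  pose B2 (l : nat) := if l == j then B' else B l.
  have mA2 l : measurable (A2 l) by rewrite /A2; case: ifP.
  have mB2 l : measurable (B2 l) by rewrite /B2; case: ifP.
  have ne (l : nat) : l \in s2 -> (l == j) = false.
    by move=> ls; apply: contraNF js2 => /eqP <-.
  have eA : A2 j = A' by rewrite /A2 eqxx.
  have eB : B2 j = B' by rewrite /B2 eqxx.
  have e1 : box s2 A2 B2 = box s2 A B.
    by apply: eq_big_seq => l ls; rewrite /A2 /B2 (ne _ ls).
  have e2 : (\prod_(l <- s2) (mu (A2 l) * nu (B2 l)) =
             \prod_(l <- s2) (mu (A l) * nu (B l)))%E.
    by apply: eq_big_seq => l ls; rewrite /A2 /B2 (ne _ ls).
  have := IH (j :: s2) us' js' C' A2 B2 mC' mA2 mB2.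
  rewrite [in box _ _ _]/box !big_cons -/(box s2 A2 B2) eA eB e1 e2 => h.
  transitivity (P H * mu C' * (\prod_(i <- s1) q i)%:E *
    (mu A' * nu B' * \prod_(l <- s2) (mu (A l) * nu (B l))))%E.
    rewrite -h; congr (P _); rewrite /G; apply/seteqP; split => w /=; tauto.
  rewrite /x -!muleA; congr (P H * _)%E.
  rewrite muleCA; congr (_ * _)%E.
  by rewrite [RHS]muleC -!muleA.
rewrite -(fineK xfin) in rect.
have mZX : measurable_fun setT (fun w => (Z w, X j w)) by exact: measurable_fun_pair.
have step1 B' (mB' : measurable B') D2 (mD2 : measurable D2) :
    P (G `&` ([set w | D2 (Z w, X j w)] `&` Y j @^-1` B')) =
    ((fine x)%:E * ((mu \x mu)%E D2 * nu B'))%E.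
  have mGB : measurable (G `&` Y j @^-1` B').
    by apply: measurableI => //; exact: mpre.
  have nuB : nu B' = (fine (nu B'))%:E by rewrite fineK ?fin_num_measure.
  have := @joint_law_product _ _ _ P _ _ _ _ mu mu Z (X j) _
    (fine x * fine (nu B')) mZ (mX j) mGB _ _ mD2.
  rewrite EFinM -nuB => h; transitivity ((fine x)%:E * nu B' * (mu \x mu) D2)%E.
    rewrite -h; first by congr (P _); apply/seteqP; split => w /=; tauto.
    move=> A1 B1 mA1 mB1; rewrite -muleA [X in (_ * X)%E]muleC -rect//.
    by congr (P _); apply/seteqP; split => w /=; tauto.
  by rewrite -muleA; congr (_ * _)%E; rewrite muleC.
have mDC : measurable (D j `&` [set p | C p.1.1]).
  apply: measurableI => //.
  rewrite -[X in measurable X]setTI.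
  exact: (measurableT_comp measurable_fst measurable_fst).
have := @joint_law_product _ _ _ P _ _ _ _ (mu \x mu)%E nu
  (fun w => (Z w, X j w)) (Y j) G (fine x) mZX (mY j) mG _ _ mDC.
rewrite Dq// big_cons => h.
transitivity ((fine x)%:E * (mu C * (q j)%:E))%E.
  rewrite -h; first by congr (P _); rewrite /G; apply/seteqP; split => w /=; tauto.
  by move=> A1 B1 mA1 mB1; exact: step1.
rewrite (fineK xfin) /x big_cons EFinM -!muleA; congr (P H * _)%E.
by rewrite muleA [LHS]muleC -muleA.
Qed.

(** The leaves of a star with centre Z are the X j, and the edge to X j bears the
    mark Y j. Although the events E j all involve Z, they are independent of each
    other and of H, because the conditional probability of E j given Z is the
    constant q j (this is the hypothesis [Dq]). *)
Lemma star_independence (s : seq nat) : uniq s -> all J s ->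
  P (H `&` \big[setI/setT]_(j <- s) E j) = (P H * (\prod_(j <- s) q j)%:E)%E.
Proof.
move=> us js; have := @star_box s [::]; rewrite cats0.
move=> /(_ us js setT (fun=> setT) (fun=> setT)).
rewrite /box !big_nil preimage_setT !setIT probability_setT !mule1.
exact.
Qed.

End star_independence.

(** * Binomial counts and Poisson thinning *)

Section number_of_successes.
Context {R : realType} {disp : measure_display} {Omega : measurableType disp}.
Variable P : probability Omega R.
Variables (I : finType) (O : {set I}) (e : I -> set Omega) (H : set Omega).
Variables (p q : R).
Hypotheses (mH : measurable H) (me : forall i, measurable (e i)).

Definition pattern_event (K : {set I}) : set Omega :=
  H `&` \big[setI/setT]_(j <- enum O) (if j \in K then e j else ~` e j).

Definition success_set (w : Omega) : {set I} := [set j in O | `[< e j w >]].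

Hypothesis pattern : forall K : {set I}, K \subset O ->
  P (pattern_event K) = (P H * (p ^+ #|K| * q ^+ (#|O| - #|K|))%:E)%E.

(** An outcome pattern is the same thing as a value of the random set of successes,
    so that distinct patterns exclude each other. *)
Lemma pattern_eventE (K : {set I}) : K \subset O ->
  pattern_event K = H `&` [set w | success_set w = K].
Proof.
move=> /fintype.subsetP KO; rewrite /pattern_event -bigcap_seq.
apply/seteqP; split => w /= [Hw].
  move=> h; split => //; apply/setP => j; rewrite inE.
  have [jO|jO] /= := boolP (j \in O); last first.
    by apply/esym/negbTE; apply: contra jO; exact: KO.
  have := h j; rewrite /= mem_enum => /(_ jO).
  by case: ifPn => jK ejw; [rewrite asboolT|rewrite asboolF].
move=> wK; split => // j; rewrite /= mem_enum => jO.
by rewrite -wK inE jO /=; case: asboolP.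
Qed.

Lemma measurable_pattern_event K : measurable (pattern_event K).
Proof.
apply: measurableI => //; apply: bigsetI_measurable => i _.
by case: ifP => _ //; exact: measurableC.
Qed.

Let num_event (Q : pred nat) : set Omega :=
  H `&` [set w | Q #|success_set w|].

Let num_eventE (Q : pred nat) : num_event Q =
  \bigcup_(K in [set K : {set I} | (K \subset O) && Q #|K|]) pattern_event K.
Proof.
apply/seteqP; split => w.
  move=> [Hw /= Qw]; have sO : success_set w \subset O.
    by apply/fintype.subsetP => j; rewrite inE => /andP[].
  by exists (success_set w); [rewrite /= sO|rewrite pattern_eventE].
move=> [K /= /andP[KO QK]].
by rewrite pattern_eventE// => -[Hw /= wK]; split => //=; rewrite wK.
Qed.

Lemma measurable_num_successes (Q : pred nat) :
  measurable (H `&` [set w | Q #|success_set w|]).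
Proof.
rewrite -/(num_event Q) num_eventE; apply: fin_bigcup_measurable.
  exact: finite_finset.
by move=> K _; exact: measurable_pattern_event.
Qed.

Lemma num_successes_law (Q : pred nat) :
  P (H `&` [set w | Q #|success_set w|]) =
  (P H * (\sum_(l < #|O|.+1 | Q l)
             'C(#|O|, l)%:R * (p ^+ l * q ^+ (#|O| - l)))%:E)%E.
Proof.
have [x Px] : exists x : R, P H = x%:E.
  by exists (fine (P H)); rewrite fineK// fin_num_measure.
rewrite -/(num_event Q) num_eventE measure_fin_bigcup.
- transitivity (\sum_(K : {set I} | (K \subset O) && Q #|K|)
     (P H * (p ^+ #|K| * q ^+ (#|O| - #|K|))%:E))%E.
    have -> : [set K : {set I} | (K \subset O) && Q #|K|] =
       [set` enum [pred K : {set I} | (K \subset O) && Q #|K|]].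
      by apply/seteqP; split => K; rewrite /= mem_enum inE.
    rewrite -fsbig_seq ?enum_uniq// big_enum_cond /=.
    apply: eq_big => [K|K]; rewrite inE /= andbT// => /andP[KO _].
    exact: pattern.
  rewrite Px; under eq_bigr do rewrite -EFinM.
  rewrite sumEFin; congr EFin; rewrite mulr_sumr.
  rewrite (partition_big (fun K : {set I} => inord #|K| : 'I_#|O|.+1) (fun l => Q l)).
    apply: eq_bigr => l Ql.
    transitivity (\sum_(K in [set K : {set I} | (K \subset O) && (#|K| == l)]%SET)
       x * (p ^+ l * q ^+ (#|O| - l))).
      apply: eq_big => K.
        rewrite inE; apply/idP/idP => [/andP[/andP[KO QK]] /eqP <-|/andP[KO /eqP Kl]].
          by rewrite KO inordK/= ?eqxx// ltnS subset_leq_card.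
        by rewrite KO Kl Ql -val_eqE /= inordK ?Kl// eqxx.
      move=> /andP[/andP[KO QK]] /eqP <-.
      by rewrite inordK// ltnS subset_leq_card.
    rewrite sumr_const cards_draws.
    by rewrite -[LHS]mulr_natl mulrCA.
  by move=> K /andP[KO QK]; rewrite inordK// ltnS subset_leq_card.
- exact: finite_finset.
- move=> K L /= /andP[KO _] /andP[LO _] [w []].
  by rewrite !pattern_eventE// => -[_ <-] [_ <-].
- by move=> K _; exact: measurable_pattern_event.
Qed.

End number_of_successes.

Section poisson_series.
Context {R : realType}.
Local Open Scope ereal_scope.

Lemma nneseries_single (f : nat -> \bar R) n : (forall k, 0 <= f k) ->
  (forall k, k != n -> f k = 0) -> \sum_(k <oo) f k = f n.
Proof.
move=> f0 fn; rewrite (@nneseriesD1 _ _ n)//.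
by rewrite eseries0 ?adde0// => i _ /= /fn.
Qed.

Lemma nneseries_expR (x : R) : (0 <= x)%R ->
  \sum_(j <oo) (x ^+ j / j`!%:R)%:E = (expR x)%:E.
Proof.
move=> x0; rewrite expRE -EFin_lim; last first.
  rewrite /pseries/=; under eq_fun do rewrite mulrC.
  exact: is_cvg_series_exp_coeff.
apply/congr_lim/funext => n/=; rewrite /pseries/= /series/= -sumEFin//.
by under eq_bigr do rewrite mulrC.
Qed.

(** The number of successes in a Poisson number of trials is Poisson: the term of
    indices M and l factors into a term of index l of mean n p and a term of index
    M - l of mean n (1 - p), and the sum over M of the latter is an exponential
    series. *)
Lemma poisson_thinning (n p : R) (Q : pred nat) : (0 <= n)%R -> (0 <= p <= 1)%R ->
  \sum_(M <oo) (n ^+ M / M`!%:R * expR (- n) *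
     \sum_(l < M.+1 | Q l) 'C(M, l)%:R * (p ^+ l * (1 - p) ^+ (M - l)))%:E =
  \sum_(l <oo | Q l) ((n * p) ^+ l / l`!%:R * expR (- (n * p)))%:E.
Proof.
move=> n0 /andP[p0 p1]; have q0 : (0 <= 1 - p)%R by rewrite subr_ge0.
pose a (M l : nat) : \bar R := if (l <= M)%N then
   ((n * p) ^+ l / l`!%:R * ((n * (1 - p)) ^+ (M - l) / (M - l)`!%:R)
     * expR (- n))%:E else 0.
have a0 M l : 0 <= a M l.
  rewrite /a; case: ifP => // _.
  by rewrite lee_fin !mulr_ge0 ?invr_ge0 ?exprn_ge0 ?mulr_ge0 ?expR_ge0.
transitivity (\sum_(M <oo) \sum_(l <oo | Q l) a M l).
  apply: eq_eseriesr => M _.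
  rewrite (@nneseries_split_cond _ _ 0 M.+1 Q)// add0n.
  rewrite [X in _ + X]eseries_cond [X in _ + X]eseries0 ?adde0; last first.
    by move=> i _ /andP[_ Mi]; rewrite /a leqNgt Mi.
  rewrite big_mkord mulr_sumr -sumEFin; apply: eq_bigr => l Ql.
  have lM : (l <= M)%N by rewrite -ltnS.
  rewrite /a lM; congr EFin.
  have -> : (M`!%:R = 'C(M, l)%:R * (l`!%:R * (M - l)`!%:R) :> R)%R.
    by rewrite -(bin_fact lM) !natrM.
  have -> : (n ^+ M = n ^+ l * n ^+ (M - l))%R by rewrite -exprD subnKC.
  rewrite !exprMn; field.
  by rewrite !pnatr_eq0 -!lt0n !fact_gt0 bin_gt0 lM.
rewrite (@nneseries_interchange _ _ xpredT Q)//; apply: eq_eseriesr => l Ql.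
rewrite (@nneseries_split _ _ 0 l)// add0n.
rewrite big_nat_cond [X in X + _]big1 ?add0e; last first.
  by move=> M /andP[/andP[_ Ml] _]; rewrite /a leqNgt Ml.
rewrite -nneseries_addn//.
under eq_eseriesr => M _.
  rewrite /a leq_addl addnK mulrAC EFinM.
  over.
rewrite nneseriesZl/=; last first.
  by move=> M _; rewrite lee_fin mulr_ge0 ?invr_ge0 ?exprn_ge0 ?mulr_ge0.
rewrite nneseries_expR ?mulr_ge0// -EFinM -[X in X%:E = _]mulrA.
by rewrite -expRD; congr (_ * expR _)%:E; ring.
Qed.

Lemma poisson_tail (m : nat) (x : R) (Q : pred nat) : (0 <= x)%R ->
  (forall l, Q l = (m < l)%N) ->
  \sum_(l <oo | Q l) (x ^+ l / l`!%:R * expR (- x))%:E =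
  1 - (poisson_cdf m x)%:E.
Proof.
move=> x0 Qm.
have f0 l : 0 <= (x ^+ l / l`!%:R * expR (- x))%:E.
  by rewrite lee_fin mulr_ge0 ?expR_ge0 ?divr_ge0 ?exprn_ge0.
have tot : \sum_(l <oo) (x ^+ l / l`!%:R * expR (- x))%:E = 1.
  under eq_eseriesr do rewrite mulrC EFinM.
  rewrite nneseriesZl/=; last by move=> l _; rewrite lee_fin divr_ge0 ?exprn_ge0.
  by rewrite nneseries_expR// -EFinM -expRD addNr expR0.
rewrite -tot (@nneseries_split _ _ 0 m.+1)// add0n big_mkord sumEFin.
rewrite -/(poisson_cdf m x) addeAC subee// add0e.
rewrite [RHS]eseries_cond; apply/congr_lim/funext => n.
by apply: eq_bigl => l; rewrite Qm.
Qed.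

End poisson_series.

(** * Degrees in the random connection graph *)

Section independence_seq.
Context {R : realType} {disp : measure_display} {Omega : measurableType disp}.
Variable P : probability Omega R.

Lemma mutually_independent_seq (I : choiceType) (J : set I)
    (F : I -> set_system Omega) (s : seq I) (A : I -> set Omega) :
  mutually_independent P J F -> uniq s ->
  (forall i, i \in s -> J i) -> (forall i, i \in s -> F i (A i)) ->
  P (\big[setI/setT]_(i <- s) A i) = (\prod_(i <- s) P (A i))%E.
Proof.
move=> indep us sJ sF.
have sE : [set` [fset i in s]%fset] = [set` s].
  by apply/seteqP; split => i; rewrite /= inE.
rewrite -bigcap_seq -sE indep; last 2 first.
- by rewrite sE => i /= /sJ.
- by move=> i; rewrite inE; exact: sF.
apply: perm_big; apply: uniq_perm => //.
by move=> i; rewrite inE.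
Qed.

Lemma sigma_RVs_bigsetI (I : Type) (J : set I) d (T : measurableType d)
    (Y : I -> Omega -> T) (K : eqType) (s : seq K) (f : K -> I) (A : K -> set T) :
  (forall k, k \in s -> J (f k)) -> (forall k, measurable (A k)) ->
  sigma_RVs J Y (\big[setI/setT]_(k <- s) (Y (f k) @^-1` A k)).
Proof.
move=> sJ mA; rewrite big_seq.
apply: (@bigsetI_measurable _
  (g_sigma_algebraType (\bigcup_(i in J) sigma_RV (Y i)))) => k ks.
apply: sub_sigma_algebra; exists (f k); first exact: sJ.
by exists (A k) => //; rewrite setTI.
Qed.

Lemma independent_3 (F0 F1 F2 : set_system Omega) (A0 A1 A2 : set Omega) :
  mutually_independent P [set: 'I_3] (tnth [tuple F0; F1; F2]) ->
  F0 A0 -> F1 A1 -> F2 A2 ->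
  P (A0 `&` A1 `&` A2) = (P A0 * P A1 * P A2)%E.
Proof.
move=> indep FA0 FA1 FA2.
have := @mutually_independent_seq _ _ _ (enum 'I_3) (tnth [tuple A0; A1; A2])
  indep (enum_uniq _) (fun=> fun=> I).
rewrite !big_enum /= !big_ord_recr !big_ord0 /= setTI mul1e.
rewrite !(tnth_nth set0) /=; apply => -[[|[|[|//]]] i3] _;
  by rewrite !(tnth_nth set0).
Qed.

End independence_seq.

Section degree_law.
Context {R : realType} {disp : measure_display} {Omega : measurableType disp}.
Variable P : probability Omega R.
Context {dT : measure_display} {T : measurableType dT}.
Variables (X : nat -> {RV P >-> T}) (N : nat -> {RV P >-> nat})
  (U : nat -> nat -> {RV P >-> R}).
Variables (mu : probability T R) (nu : probability R R).
Hypotheses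
  (X_law : forall i A, measurable A -> distribution P (X i) A = mu A)
  (X_indep : independent_RVs P [set: nat] X)
  (U_law : forall i j A, (i < j)%N -> measurable A ->
      distribution P (U i j) A = nu A)
  (U_indep : independent_RVs P [set ij : nat * nat | (ij.1 < ij.2)%N]
      (fun ij => U ij.1 ij.2))
  (XNU_indep : mutually_independent P [set: 'I_3]
      (tnth [tuple sigma_RVs [set: nat] X;
                   sigma_RVs [set n | (0 < n)%N] N;
                   sigma_RVs [set ij : nat * nat | (ij.1 < ij.2)%N]
                     (fun ij => U ij.1 ij.2)])).

(** Only the marks [U a b] with a < b have a prescribed law, so an edge is indexed
    by the increasing pair of its ends. *)
Definition edge_index (i j : nat) : nat * nat := (minn i j, maxn i j).

Definition edge_mark (i j : nat) : Omega -> R :=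
  U (edge_index i j).1 (edge_index i j).2.

Lemma edge_index_lt i j : j != i -> ((edge_index i j).1 < (edge_index i j).2)%N.
Proof. by rewrite /edge_index /minn /maxn /= eq_sym; case: (ltngtP i j). Qed.

Let other (i : nat) (ij : nat * nat) : nat := if ij.1 == i then ij.2 else ij.1.

Let edge_indexK i : cancel (edge_index i) (other i).
Proof.
move=> j; rewrite /other /edge_index /minn /maxn /=.
case: (ltngtP i j) => //= ij; first by rewrite eqxx.
  by rewrite ltn_eqF.
by case: ifP.
Qed.

(** For a fixed i, distinct neighbours j use distinct points and distinct marks. *)
Lemma star_boxes_indep (n m i : nat) (s : seq nat) (C : set T) (A : nat -> set T)
    (B : nat -> set R) : (0 < n)%N -> uniq s -> all (fun j => j != i) s ->
  measurable C -> (forall j, measurable (A j)) -> (forall j, measurable (B j)) ->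
  P ((N n @^-1` [set m]) `&` X i @^-1` C `&`
      \big[setI/setT]_(j <- s) (X j @^-1` A j `&` edge_mark i j @^-1` B j)) =
  (P (N n @^-1` [set m]) * mu C * \prod_(j <- s) (mu (A j) * nu (B j)))%E.
Proof.
move=> n0 us si mC mA mB.
have sne j : j \in s -> j != i by move/allP : si; exact.
pose A' j := if j == i then C else A j.
have mA' j : measurable (A' j) by rewrite /A'; case: ifP.
pose B' ij := B (other i ij).
have usi : uniq (i :: s).
  by rewrite /= us andbT; apply/negP => /sne; rewrite eqxx.
have ue : uniq (map (edge_index i) s).
  by rewrite map_inj_uniq//; exact: can_inj (edge_indexK i).
rewrite big_split /=.
set SX := \big[setI/setT]_(j <- s) (X j @^-1` A j).
set SU := \big[setI/setT]_(j <- s) _.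
have SXE : X i @^-1` C `&` SX = \big[setI/setT]_(j <- i :: s) (X j @^-1` A' j).
  rewrite big_cons /A' eqxx; congr (_ `&` _).
  by apply: eq_big_seq => j /sne /negbTE ->.
have SUE : SU = \big[setI/setT]_(ij <- map (edge_index i) s)
    (U ij.1 ij.2 @^-1` B' ij).
  by rewrite big_map; apply: eq_bigr => j _; rewrite /B' edge_indexK.
have -> : N n @^-1` [set m] `&` X i @^-1` C `&` (SX `&` SU) =
   (X i @^-1` C `&` SX) `&` N n @^-1` [set m] `&` SU.
  by apply/seteqP; split => w /=; tauto.
rewrite (independent_3 XNU_indep).
- have -> : P (X i @^-1` C `&` SX) = (mu C * \prod_(j <- s) mu (A j))%E.
    rewrite SXE (mutually_independent_seq X_indep usi) => //; last first.
      by move=> j _; exists (A' j) => //; rewrite setTI.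
    rewrite big_cons /A' eqxx; congr (_ * _)%E; first exact: X_law.
    by apply: eq_big_seq => j /sne /negbTE ->; exact: X_law.
  have -> : P SU = (\prod_(j <- s) nu (B j))%E.
    rewrite SUE (mutually_independent_seq U_indep ue).
    + rewrite big_map; apply: eq_big_seq => j /sne ji.
      by rewrite /B' edge_indexK; apply: U_law => //; exact: edge_index_lt.
    + by move=> _ /mapP[j /sne ji ->]; exact: edge_index_lt.
    + move=> ij _; exists (B' ij); [exact: mB|by rewrite setTI].
  by rewrite big_split /= [X in (X * _)%E]muleC -!muleA.
- by rewrite SXE; apply: sigma_RVs_bigsetI.
- apply: sub_sigma_algebra; exists n => //; exists [set m] => //.
  by rewrite setTI.
- rewrite SUE; apply: (@sigma_RVs_bigsetI _ _ _ _ _ _ (fun ij => U ij.1 ij.2) _ _ id).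
    by move=> _ /mapP[j /sne ji ->]; exact: edge_index_lt.
  by move=> ij; exact: mB.
Qed.

Variables (D : set (T * T * R)) (p : R).
Hypotheses (mD : measurable D)
  (Dp : forall C, measurable C ->
    ((mu \x mu) \x nu)%E (D `&` [set z | C z.1.1]) = (mu C * p%:E)%E).

Definition neighbour_event (i j : nat) : set Omega :=
  [set w | D ((X i w, X j w), edge_mark i j w)].

Let mstar i j : measurable_fun setT (fun w => ((X i w, X j w), edge_mark i j w)).
Proof. by apply: measurable_fun_pair => //; exact: measurable_fun_pair. Qed.

Lemma measurable_neighbour_event i j : measurable (neighbour_event i j).
Proof.
rewrite /neighbour_event -[X in measurable X]setTI.
exact: (mstar i j).
Qed.

(** Being joined and not being joined to i both have a conditional probability
    given X i that is constant, namely p and 1 - p, so any pattern of neighbours is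
    an instance of [star_independence]. *)
Lemma neighbour_pattern_law (n m : nat) (i : 'I_m) (K : {set 'I_m}) :
  (0 < n)%N -> K \subset [set~ i]%SET ->
  P (pattern_event [set~ i]%SET (fun j : 'I_m => neighbour_event i j)
       (N n @^-1` [set m]) K) =
  (P (N n @^-1` [set m]) *
     (p ^+ #|K| * (1 - p) ^+ (#|[set~ i]%SET| - #|K|))%:E)%E.
Proof.
move=> n0 Ki.
pose inK (j : nat) := j \in map val (enum K).
have inKE (j : 'I_m) : inK j = (j \in K).
  by rewrite /inK mem_map ?mem_enum//; exact: val_inj.
pose D' j := if inK j then D else ~` D.
pose q j := if inK j then p else 1 - p.
have mD' j : measurable (D' j) by rewrite /D'; case: ifP => // _; exact: measurableC.
have Dq j C : measurable C ->
    ((mu \x mu) \x nu)%E (D' j `&` [set z | C z.1.1]) = (mu C * (q j)%:E)%E.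
  move=> mC; rewrite /D' /q; case: ifP => _; first exact: Dp.
  have mCC : measurable [set z : T * T * R | C z.1.1].
    rewrite -[X in measurable X]setTI.
    exact: (measurableT_comp measurable_fst measurable_fst).
  have tot : ((mu \x mu) \x nu)%E [set z : T * T * R | C z.1.1] = mu C.
    have -> : [set z : T * T * R | C z.1.1] = (C `*` setT) `*` setT.
      by apply/seteqP; split => -[[x y] u] /=; tauto.
    rewrite product_measure1E//; last exact: measurableX.
    rewrite [X in (_ * X)%E](_ : _ = 1%E) ?mule1; last exact: (probability_setT nu).
    rewrite /= product_measure1E//.
    by rewrite [X in (_ * X)%E](_ : _ = 1%E) ?mule1; last exact: (probability_setT mu).
  rewrite setIC -setDE measureD//=; last first.
    by rewrite tot (le_lt_trans (probability_le1 mu mC)) ?ltry.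
  rewrite tot setIC Dp// -(fineK (fin_num_measure mu C mC)) -!EFinM -EFinB.
  by rewrite mulrBr mulr1.
pose s := map val (enum [set~ i]%SET).
have us : uniq s by rewrite map_inj_uniq ?enum_uniq//; exact: val_inj.
have si : all (fun j => j != i :> nat) s.
  by apply/allP => j' /mapP[j]; rewrite mem_enum !inE => ji ->.
have mH : measurable (N n @^-1` [set m]).
  by rewrite -[X in measurable X]setTI; exact: measurable_funP.
have := @star_independence _ _ _ P _ _ _ _ mu nu (X i) X (edge_mark i)
  (N n @^-1` [set m]) (fun j => j != i) _ _ _ mH _ D' q mD' Dq s us si.
rewrite /s !big_map /pattern_event => h.
have -> : \big[setI/setT]_(j <- enum [set~ i]%SET)
    (if j \in K then neighbour_event i j else ~` neighbour_event i j) =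
  \big[setI/setT]_(j <- enum [set~ i]%SET)
    [set w | D' (val j) (X i w, X (val j) w, edge_mark i (val j) w)].
  by apply: eq_bigr => j _; rewrite /D' inKE; case: ifP.
rewrite h//; last by move=> *; exact: star_boxes_indep.
congr (_ * _%:E)%E; rewrite big_enum /=.
rewrite (bigID (mem K)) /=; congr (_ * _).
  rewrite -prodr_const; apply: eq_big => [j|j /andP[_ jK]].
    have [jK|] := boolP (j \in K); rewrite ?andbF// andbT.
    exact: (fintype.subsetP Ki).
  by rewrite /q inKE jK.
rewrite -cardsDS// -prodr_const; apply: eq_big => [j|j /andP[_ /negbTE jK]].
  by rewrite !inE andbC.
by rewrite /q inKE jK.
Qed.

End degree_law.

Lemma torus_distC {R : realType} (d : nat) (x y : d.-tuple R) :
  torus_dist x y = torus_dist y x.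
Proof.
suff h (a b : d.-tuple R) :
    [set enorm [tuple tnth a i - tnth b i - (tnth z i)%:~R | i < d]
      | z in [set: d.-tuple int]] `<=`
    [set enorm [tuple tnth b i - tnth a i - (tnth z i)%:~R | i < d]
      | z in [set: d.-tuple int]].
  by congr inf; apply/seteqP; split; exact: h.
move=> _ [z _ <-]; exists [tuple - tnth z i | i < d] => //.
congr Num.sqrt; apply: eq_bigr => i _; rewrite !tnth_mktuple.
by rewrite -sqrrN rmorphN /=; congr (_ ^+ 2); lra.
Qed.

Section expected_number.
Context {R : realType} {disp : measure_display} {Omega : measurableType disp}.
Variables (P : probability Omega R) (d : nat) (g : R -> R).
Variables (X : nat -> {RV P >-> d.-tuple R}) (N : nat -> {RV P >-> nat})
  (U : nat -> nat -> {RV P >-> R}).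
Variables (mu : probability (d.-tuple R) R) (nu : probability R R).
Hypotheses
  (X_law : forall i A, measurable A -> distribution P (X i) A = mu A)
  (X_indep : independent_RVs P [set: nat] X)
  (N_poisson : forall n A, (0 < n)%N ->
      distribution P (N n) A = poisson_prob n%:R 0 A)
  (U_law : forall i j A, (i < j)%N -> measurable A ->
      distribution P (U i j) A = nu A)
  (U_indep : independent_RVs P [set ij : nat * nat | (ij.1 < ij.2)%N]
      (fun ij => U ij.1 ij.2))
  (XNU_indep : mutually_independent P [set: 'I_3]
      (tnth [tuple sigma_RVs [set: nat] X;
                   sigma_RVs [set n | (0 < n)%N] N;
                   sigma_RVs [set ij : nat * nat | (ij.1 < ij.2)%N]
                     (fun ij => U ij.1 ij.2)])).

Variables (r : R) (p : R).

Definition connection_set : set (d.-tuple R * d.-tuple R * R) :=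
  [set z | z.2 <= g (torus_dist z.1.1 z.1.2 / r)].

Hypotheses (mD : measurable connection_set) (p01 : 0 <= p <= 1)
  (Dp : forall C, measurable C ->
    ((mu \x mu) \x nu)%E (connection_set `&` [set z | C z.1.1]) =
    (mu C * p%:E)%E).

Let D := connection_set.

Lemma adjacentE m (i j : 'I_m) w :
  Defs.adjacent g (X ^~ w) (fun i j => U i j w) r i j =
  (j \in [set~ i]%SET) && `[< neighbour_event X U D i j w >].
Proof.
rewrite !inE /Defs.adjacent /connected_lt /neighbour_event /D /connection_set /=.
rewrite /edge_mark /edge_index /minn /maxn -val_eqE /=.
case: (ltngtP i j) => ij /=.
- rewrite orbF; apply/idP/idP => [h|/asboolP//]; exact/asboolP.
- rewrite torus_distC; apply/idP/idP => [h|/asboolP//]; exact/asboolP.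
- by [].
Qed.

Let H n m : set Omega := N n @^-1` [set m].

Let high_degree n m (k : R) (i : 'I_m) : set Omega :=
  H n m `&` [set w | k <= (Defs.degree g (X ^~ w) (fun i j => U i j w) r i)%:R].

Lemma degreeE m (i : 'I_m) w :
  Defs.degree g (X ^~ w) (fun i j => U i j w) r i =
  #|success_set [set~ i]%SET (fun j : 'I_m => neighbour_event X U D i j) w|.
Proof.
by rewrite /Defs.degree; apply: eq_card => j; rewrite !inE adjacentE !inE.
Qed.

Let mH n m : measurable (H n m).
Proof. by rewrite -[X in measurable X]setTI; exact: measurable_funP. Qed.

Let mE m (i j : 'I_m) : measurable (neighbour_event X U D i j).
Proof. exact: measurable_neighbour_event. Qed.

Let high_degreeE n m (k : R) (i : 'I_m) : high_degree n k i =
  H n m `&` [set w | k <=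
   #|success_set [set~ i]%SET (fun j : 'I_m => neighbour_event X U D i j) w|%:R].
Proof. by rewrite /high_degree; under eq_set do rewrite degreeE. Qed.

Let measurable_high_degree n m (k : R) (i : 'I_m) : measurable (high_degree n k i).
Proof.
rewrite high_degreeE.
exact: (@measurable_num_successes _ _ _ _ _ (H n m) (mH n m) _ (fun l => k <= l%:R)).
Qed.

Lemma degree_law n M (k : R) (i : 'I_M.+1) : (0 < n)%N ->
  P (high_degree n k i) = (P (H n M.+1) * (\sum_(l < M.+1 | k <= l%:R)
     'C(M, l)%:R * (p ^+ l * (1 - p) ^+ (M - l)))%:E)%E.
Proof.
move=> n0; have cO : #|[set~ i]%SET| = M by rewrite cardsC1 card_ord.
rewrite high_degreeE.
have := @num_successes_law _ _ _ P _ [set~ i]%SET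
  (fun j : 'I_M.+1 => neighbour_event X U D i j) (H n M.+1) p (1 - p)
  (mH n M.+1) (mE i) _ (fun l => k <= l%:R).
rewrite cO; apply => K Ki; rewrite -{}[in X in (1 - p) ^+ (X - _)]cO.
exact: (@neighbour_pattern_law _ _ _ P _ _ X N U mu nu).
Qed.

Lemma prob_poisson_count n m : (0 < n)%N ->
  P (H n m) = (n%:R ^+ m / m`!%:R * expR (- n%:R))%:E.
Proof.
by move=> n0; have := N_poisson [set m] n0;
  rewrite /poisson_prob /poisson_pmf ltr0n n0 esum_set1//.
Qed.

(** Given N n = M + 1, each of the M + 1 vertices has a binomial degree with M
    trials. Since M + 1 times the Poisson weight of M + 1 is n times the Poisson
    weight of M, the expected proportion is a Poisson mixture of binomial tails,
    which thinning turns into a Poisson tail: a typical vertex has a Poisson number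
    of neighbours of mean n p. *)
Lemma expected_num_degree_ge n (k : R) : (0 < n)%N ->
  ('E_P[fun w => ((num_degree_ge g (X ^~ w) (fun i j => U i j w) (N n w) r k)%:R
     / n%:R)%R] =
  \sum_(l <oo | (k <= l%:R)%R)
    ((n%:R * p) ^+ l / l`!%:R * expR (- (n%:R * p)))%:E)%E.
Proof.
move=> n0.
have in0 : (0 <= (n%:R^-1 : R)%:E)%E by rewrite lee_fin invr_ge0.
have i0 m (i : 'I_m) w : (0 <= (\1_(high_degree n k i) w : R)%:E)%E.
  by rewrite lee_fin indicE.
pose F m w : \bar R := (\sum_(i < m)
  (n%:R^-1)%:E * (\1_(high_degree n k i) w)%:E)%E.
have F0 m w : (0 <= F m w)%E.
  by apply: sume_ge0 => i _; exact: mule_ge0.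
have FE w : ((num_degree_ge g (X ^~ w) (fun i j => U i j w) (N n w) r k)%:R
     / n%:R)%:E = (\sum_(m <oo) F m w)%E.
  rewrite (@nneseries_single _ _ (N n w))//; last first.
    move=> m mN; apply: big1 => i _; rewrite indicE memNset ?mule0//.
    by move=> [/= Nm _]; rewrite Nm eqxx in mN.
  rewrite /F -ge0_sume_distrr//.
  rewrite sumEFin -EFinM mulrC; congr (_ * _)%:E.
  rewrite /num_degree_ge -sum1_card natr_sum big_mkcond /=; apply: eq_bigr => i _.
  rewrite indicE inE /=; case: ifPn => hk; first by rewrite mem_set.
  by rewrite memNset// => -[_ /= h]; rewrite h in hk.
have mF m : measurable_fun setT (F m).
  apply: emeasurable_sum => i; apply: emeasurable_funM => //.
  by apply/measurable_EFinP; apply: measurable_indic.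
rewrite unlock; under eq_integral do rewrite FE.
rewrite integral_nneseries//.
have IF m : (\int[P]_w F m w = \sum_(i < m) (n%:R^-1)%:E * P (high_degree n k i))%E.
  rewrite ge0_integral_sum//; last first.
    move=> i; apply: emeasurable_funM => //.
    by apply/measurable_EFinP; apply: measurable_indic.
  apply: eq_bigr => i _.
  rewrite ge0_integralZl//; last first.
    by apply/measurable_EFinP; apply: measurable_indic.
  by rewrite integral_indic// setIT.
under eq_eseriesr do rewrite IF.
(* the graph without vertices contributes nothing, so the series starts at 1 *)
rewrite (@nneseries_split _ _ 0 1)//; last first.
  by move=> m _; apply: sume_ge0 => i _; exact: mule_ge0.
rewrite add0n big_nat1 big_ord0 add0e -nneseries_addn; last first.
  by move=> m; apply: sume_ge0 => i _; exact: mule_ge0.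
rewrite -(poisson_thinning (fun l => k <= l%:R))//.
apply: eq_eseriesr => M _; rewrite addn1.
under eq_bigr do rewrite degree_law// prob_poisson_count// -!EFinM.
rewrite sumEFin sumr_const card_ord -mulr_natl; congr EFin.
rewrite exprS factS natrM; field.
by rewrite nat1r !pnatr_eq0 -!lt0n fact_gt0 n0.
Qed.

End expected_number.

(** * Distances on the circle and on the torus *)

Section circle.
Context {R : realType}.
Local Notation mu := (@lebesgue_measure R).
Implicit Types (a b t : R).

(** The image of Lebesgue measure under an affine map, once rescaled, agrees with
    Lebesgue measure on the intervals. *)
Lemma ge0_integral_affine a b (D : set R) (f : R -> \bar R) : 0 < a ->
  measurable D -> measurable_fun setT f -> (forall x, 0 <= f x)%E ->
  (\int[mu]_(x in D) f x =
   a%:E * \int[mu]_(x in [set x | D (a * x + b)%R]) f (a * x + b)%R)%E.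
Proof.
move=> a0 mD mf f0.
pose phi : measurableTypeR R -> measurableTypeR R := fun x => a * x + b.
have mphi : measurable_fun setT phi.
  by apply: measurable_funD => //; exact: measurable_funM.
pose m : {measure set (measurableTypeR R) -> \bar R} :=
  mscale (NngNum (ltW a0)) (pushforward mu phi).
have mE A : measurable A -> mu A = m mphi A.
  move=> mA; apply: lebesgue_measure_unique => //= _ [[u v]] _ <-.
  rewrite /mscale /= /pushforward.
  have -> : phi @^-1` `]u, v] = `](u - b) / a, (v - b) / a]%classic.
    apply/seteqP; split => x; rewrite /phi /= !in_itv /=.
      by rewrite ltr_pdivrMr// ler_pdivlMr//; lra.
    by rewrite ltr_pdivrMr// ler_pdivlMr//; lra.
  rewrite !lebesgue_measure_itv /= !lte_fin ltr_pM2r ?invr_gt0// ltrD2r.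
  case: ifP => _; last by rewrite mule0.
  by rewrite -!EFinD -EFinM; congr EFin; field; rewrite lt0r_neq0.
rewrite (eq_measure_integral (m mphi)); last by move=> A mA _; exact: mE.
rewrite ge0_integral_mscale//; last exact: measurable_funTS.
congr (_ * _)%E.
rewrite ge0_integral_pushforward//.
exact: measurable_funTS.
Qed.

(** The distance to the nearest integer. *)
Definition circle_dist t : R := `|t - (Num.ceil (t - 2^-1))%:~R|.

Lemma circle_dist_le_half t : circle_dist t <= 2^-1.
Proof.
rewrite /circle_dist; have /andP[] := ceil_itv (t - 2^-1) => h1 h2.
rewrite ler_norml; move: h1 h2; rewrite intrB; lra.
Qed.

(** Any integer other than the nearest one is at distance at least 1 from it, and
    the distance to the nearest one is at most 1/2. *)
Lemma circle_dist_le t (z : int) : circle_dist t <= `|t - z%:~R|.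
Proof.
have := circle_dist_le_half t; rewrite {2}/circle_dist.
set c := Num.ceil _ => h.
have [->|zc] := eqVneq z c; first by [].
have : 1 <= `|(z - c)%:~R| :> R.
  by rewrite -intr_norm ler1z -gtz0_ge1 normr_gt0 subr_eq0.
rewrite intrB; have -> : z%:~R - c%:~R = (t - c%:~R) - (t - z%:~R) :> R by ring.
move/le_trans => /(_ _ (ler_normB _ _)); move: h; rewrite /circle_dist -/c; lra.
Qed.

Lemma circle_dist_itv t : - 2^-1 < t <= 2^-1 -> circle_dist t = `|t|.
Proof.
move=> ht; rewrite /circle_dist.
by rewrite (_ : Num.ceil _ = 0) ?subr0//; apply: ceil_def; rewrite /=; lra.
Qed.

Lemma circle_distD1 t : circle_dist (t + 1) = circle_dist t.
Proof.
apply/eqP; rewrite eq_le; apply/andP; split.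
  apply: le_trans (circle_dist_le (t + 1) (Num.ceil (t - 2^-1) + 1)) _.
  by rewrite intrD /circle_dist le_eqVlt; apply/orP; left; apply/eqP; congr `|_|; ring.
apply: le_trans (circle_dist_le t (Num.ceil (t + 1 - 2^-1) - 1)) _.
by rewrite intrB /circle_dist le_eqVlt; apply/orP; left; apply/eqP; congr `|_|; ring.
Qed.

Lemma circle_distN t : circle_dist (- t) = circle_dist t.
Proof.
have h u : circle_dist (- u) <= circle_dist u.
  apply: le_trans (circle_dist_le (- u) (- Num.ceil (u - 2^-1))) _.
  by rewrite rmorphN /= -opprD normrN.
by apply/eqP; rewrite eq_le h -[in X in X <= _](opprK t) h.
Qed.

Lemma measurable_circle_dist : measurable_fun setT circle_dist.
Proof.
have mc : measurable_fun setT (fun t : R => (Num.ceil (t - 2^-1))%:~R : R).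
  apply: nondecreasing_measurable => // x y xy.
  by rewrite ler_int; apply: ceil_le; lra.
apply: (measurableT_comp (@normr_measurable R setT)).
exact: measurable_funB.
Qed.

(** After a translation by an integer, the interval is ]c, c + 1] with c between
    -1/2 and 1/2; the part beyond 1/2 is then moved back by 1. *)
Lemma integral_periodic (h : R -> \bar R) a : measurable_fun setT h ->
  (forall x, 0 <= h x)%E -> (forall x, h (x + 1) = h x) ->
  (\int[mu]_(x in `]a, (a + 1)%R]) h x =
   \int[mu]_(x in `](- 2^-1)%R, (2^-1)%R]) h x)%E.
Proof.
move=> mh h0 h1.
have shift u v w : (forall x, h (x + w) = h x) ->
    (\int[mu]_(x in `]u, v]) h x = \int[mu]_(x in `](u - w)%R, (v - w)%R]) h x)%E.
  move=> hw; rewrite (@ge0_integral_affine 1 w)// mul1e.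
  have -> : [set x | `]u, v]%classic (1 * x + w)] = `](u - w), (v - w)]%classic.
    by apply/seteqP; split => x /=; rewrite !in_itv /=; lra.
  by apply: eq_integral => x _; rewrite mul1r hw.
have hn (n : nat) x : h (x + n%:R) = h x.
  by elim: n => [|n IH]; rewrite ?addr0// -natr1 addrA h1.
have hz (z : int) x : h (x + z%:~R) = h x.
  case: z => n; first exact: hn.
  by rewrite NegzE rmorphN /= -(hn n.+1 (x - _)) subrK.
pose z := Num.floor (a + 2^-1); pose c := a - z%:~R.
rewrite (shift _ _ z%:~R)//.
have /andP[z1 z2] := floor_itv (a + 2^-1); rewrite intrD in z2.
have -> : a + 1 - z%:~R = c + 1 by rewrite /c; ring.
rewrite -/c; have c1 : - 2^-1 <= c by rewrite /c; lra.
have c2 : c < 2^-1 by rewrite /c; lra.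
rewrite (@itv_bndbnd_setU _ _ (BRight c) (BRight 2^-1) (BRight (c + 1)));
  [|by rewrite bnd_simp; lra|by rewrite bnd_simp; lra].
rewrite (@itv_bndbnd_setU _ _ (BRight (- 2^-1)) (BRight c) (BRight 2^-1));
  [|by rewrite bnd_simp; lra|by rewrite bnd_simp; lra].
have disj (u v w : R) : [disjoint `]u, v]%classic & `]v, w]%classic].
  apply/disj_setPS => x /=; rewrite !in_itv/= => -[/andP[_ xv] /andP[vx _]]; lra.
rewrite !ge0_integral_setU//=; try exact: measurable_funTS.
rewrite addeC; congr (_ + _)%E.
rewrite (shift _ _ 1)//.
by rewrite addrK (_ : 2^-1 - 1 = - 2^-1)//; lra.
Qed.

(** For any t, the squared distance on the circle of a uniform point to t has the
    law of the square of a uniform point, and scaling does the rest. *)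
Lemma integral_circle (f : R -> \bar R) t (r : R) : 0 < r ->
  measurable_fun setT f -> (forall x, 0 <= f x)%E ->
  (\int[mu]_(y in `](- 2^-1)%R, (2^-1)%R]) f (circle_dist (t - y) ^+ 2 / r ^+ 2)%R =
   r%:E * \int[mu]_(y in `](- 2^-1 / r)%R, (2^-1 / r)%R]) f (y ^+ 2)%R)%E.
Proof.
move=> r0 mf f0.
pose h (y : R) : \bar R := f (circle_dist y ^+ 2 / r ^+ 2).
have mh : measurable_fun setT h.
  apply: measurableT_comp => //; apply: measurable_funM => //.
  by apply: measurable_funX; exact: measurable_circle_dist.
have h1 x : h (x + 1) = h x by rewrite /h circle_distD1.
have h0 x : (0 <= h x)%E by exact: f0.
transitivity (\int[mu]_(y in `](- 2^-1 - t)%R, (- 2^-1 - t + 1)%R]) h y)%E.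
  rewrite [RHS](@ge0_integral_affine 1 (- t))// mul1e.
  have -> : [set x | `]- 2^-1 - t, - 2^-1 - t + 1]%classic (1 * x + - t)] =
      `]- 2^-1, 2^-1]%classic.
    by apply/seteqP; split => x /=; rewrite !in_itv /=; lra.
  by apply: eq_integral => y _; rewrite /h mul1r -circle_distN opprB.
rewrite integral_periodic// [LHS](@ge0_integral_affine r 0)//; congr (_ * _)%E.
have -> : [set x | `]- 2^-1, 2^-1]%classic (r * x + 0)] =
    `](- 2^-1 / r), (2^-1 / r)]%classic.
  apply/seteqP; split => x /=; rewrite !in_itv /= addr0.
    by rewrite ltr_pdivrMr// ler_pdivlMr// ![x * r]mulrC.
  by rewrite ltr_pdivrMr// ler_pdivlMr// ![x * r]mulrC.
apply: eq_integral => y; rewrite inE /= in_itv /= => hy.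
rewrite /h addr0 circle_dist_itv; last first.
  by move: hy; rewrite ltr_pdivrMr// ler_pdivlMr// ![y * r]mulrC.
rewrite real_normK ?num_real// exprMn mulrAC divff ?mul1r//.
by rewrite expf_neq0// lt0r_neq0.
Qed.

End circle.

Section tuple_integrals.
Context {R : realType}.
Local Notation mu := (@lebesgue_measure R).
Local Open Scope ereal_scope.

Lemma integral_lebesgue_tupleS n (f : n.+1.-tuple R -> \bar R) :
  measurable_fun setT f -> (forall t, 0 <= f t) ->
  \int[lebesgue_tuple n.+1]_t f t =
  \int[mu]_x \int[lebesgue_tuple n]_t f (tcons (x, t)).
Proof.
move=> mf f0.
transitivity (\int[mu \x (lebesgue_tuple n)]_z f (tcons z)).
  rewrite -[in RHS](@preimage_setT _ _ (@tcons R n)).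
  pose m : {measure set (measurableTypeR R * n.-tuple R) -> \bar R} :=
    mu \x (lebesgue_tuple n).
  have mt : measurable_fun [set: measurableTypeR R * n.-tuple R] (@tcons R n).
    exact: measurable_tcons.
  by rewrite -(ge0_integral_pushforward mt m measurableT mf).
rewrite (@fubini_tonelli1 _ _ _ _ _ mu (lebesgue_tuple n))//.
by apply: measurableT_comp => //; exact: measurable_tcons.
Qed.

Definition tuple_box n (A : set R) : set (n.-tuple R) :=
  [set t | forall i, A (tnth t i)].

Lemma measurable_tuple_box n (A : set R) : measurable A ->
  measurable (@tuple_box n A).
Proof.
move=> mA; rewrite (_ : @tuple_box n A =
    \bigcap_(i in [set: 'I_n]) [set t | A (tnth t i)]).
  apply: fin_bigcap_measurable => // i _.
  by rewrite -[X in measurable X]setTI; exact: measurable_tnth.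
by apply/seteqP; split => t /= h i; [move=> _|]; exact: h.
Qed.

Lemma tuple_box_tcons n (A : set R) x (t : n.-tuple R) :
  tuple_box A (tcons (x, t)) <-> A x /\ tuple_box A t.
Proof.
split=> [h|[Ax At] i].
  by split => [|i]; [exact: (h ord0)|have := h (lift ord0 i); rewrite tnthS].
by have [j ->|->//] := unliftP ord0 i; rewrite tnthS.
Qed.

Lemma integral_tuple_boxS n (A : set R) (f : n.+1.-tuple R -> \bar R) :
  measurable A -> measurable_fun setT f -> (forall t, 0 <= f t) ->
  \int[lebesgue_tuple n.+1]_(t in tuple_box A) f t =
  \int[mu]_(x in A) \int[lebesgue_tuple n]_(t in tuple_box A) f (tcons (x, t)).
Proof.
move=> mA mf f0; rewrite integral_mkcond integral_lebesgue_tupleS; last 2 first.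
- apply/(measurable_restrictT _ _).1; first exact: measurable_tuple_box.
  exact: measurable_funTS.
- by move=> t; rewrite patchE; case: ifP.
rewrite [RHS]integral_mkcond; apply: eq_integral => x _.
rewrite patchE; case: ifPn => [xA|xA].
  rewrite [RHS]integral_mkcond; apply: eq_integral => t _; rewrite !patchE.
  have -> // : (tcons (x, t) \in tuple_box A) = (t \in tuple_box A).
  rewrite inE in xA.
  by apply/idP/idP; rewrite !inE tuple_box_tcons => // -[].
apply: integral0_eq => t _; rewrite patchE memNset// tuple_box_tcons => -[+ _].
by move/mem_set; exact/negP.
Qed.

(** The law of a sum of functions of the coordinates depends on the functions only
    through their laws, and K is the ratio of the lengths of A and B when A and B
    are intervals. The functions may depend on i, as a squared distance to the i-th
    coordinate of a given point does. The offset s is what makes the induction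
    work: it receives the contribution of the coordinates already integrated. *)
Lemma integral_tuple_box_sum (A B : set R) (K : R) (psi : R -> R) :
  (0 <= K)%R -> measurable A -> measurable B -> measurable_fun setT psi ->
  forall n (phi : 'I_n -> R -> R) (G : R -> \bar R) (s : R),
  (forall i, measurable_fun setT (phi i)) ->
  (forall i (f : R -> \bar R), measurable_fun setT f -> (forall x, 0 <= f x) ->
    \int[mu]_(y in A) f (phi i y) = K%:E * \int[mu]_(y in B) f (psi y)) ->
  measurable_fun setT G -> (forall x, 0 <= G x) ->
  \int[lebesgue_tuple n]_(t in tuple_box A) G (s + \sum_(i < n) phi i (tnth t i))%R =
  (K ^+ n)%:E *
    \int[lebesgue_tuple n]_(t in tuple_box B) G (s + \sum_(i < n) psi (tnth t i))%R.
Proof.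
move=> K0 mA mB mpsi; elim=> [|n IH] phi G s mphi H mG G0.
  rewrite expr0 mul1e (_ : tuple_box A = tuple_box B).
    by apply: eq_integral => t _; rewrite !big_ord0.
  by apply/seteqP; split => t _ [].
have msum m (ph : 'I_m -> R -> R) : (forall i, measurable_fun setT (ph i)) ->
    measurable_fun setT (fun z : R * m.-tuple R =>
       G (z.1 + \sum_(i < m) ph i (tnth z.2 i))%R).
  move=> mph; apply: measurableT_comp => //; apply: measurable_funD => //.
  apply: measurable_sum => i.
  apply: (measurableT_comp (mph i)).
  exact: (measurableT_comp (measurable_tnth i) measurable_snd).
have msum1 m (ph : 'I_m -> R -> R) s' : (forall i, measurable_fun setT (ph i)) ->
    measurable_fun setT (fun t : m.-tuple R => G (s' + \sum_(i < m) ph i (tnth t i))%R).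
  move=> mph; rewrite -[X in measurable_fun _ X]/((fun z : R * m.-tuple R =>
    G (z.1 + \sum_(i < m) ph i (tnth z.2 i))%R) \o (fun t => (s', t))).
  by apply: measurableT_comp; [exact: msum|exact: measurable_fun_pair].
pose F : R * n.-tuple R -> \bar R :=
  (fun z => G (z.1 + \sum_(i < n) psi (tnth z.2 i))%R) \_ [set z | tuple_box B z.2].
have [L [LE mL L0]] : exists L : R -> \bar R, [/\
    forall u, L u = \int[lebesgue_tuple n]_(t in tuple_box B)
      G (u + \sum_(i < n) psi (tnth t i))%R,
    measurable_fun setT L & forall u, 0 <= L u].
  exists (fun u => \int[lebesgue_tuple n]_t F (u, t)); split.
  - move=> u; rewrite [RHS]integral_mkcond; apply: eq_integral => t _.
    by rewrite /F !patchE; congr (if _ then _ else _); apply/idP/idP; rewrite !inE.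
  - apply: (@measurable_fun_fubini_tonelli_F _ _ _ _ _ (lebesgue_tuple n) F).
      apply/(measurable_restrictT _ _).1;
        last exact: measurable_funTS (msum n (fun=> psi) (fun=> mpsi)).
      rewrite -[X in measurable X]setTI; apply: measurable_snd => //.
      exact: measurable_tuple_box.
    by move=> z; rewrite /F patchE; case: ifP.
  - by move=> u; apply: integral_ge0 => t _; rewrite /F patchE; case: ifP.
rewrite !integral_tuple_boxS//; [|exact: (msum1 _ (fun=> psi))|exact: msum1].
transitivity (\int[mu]_(y in A) ((K ^+ n)%:E * L (s + phi ord0 y)%R)).
  apply: eq_integral => y _.
  rewrite LE -(IH (fun i => phi (lift ord0 i)) G)//; last by move=> i f; exact: H.
  apply: eq_integral => t _; congr (G _); rewrite big_ord_recl addrA.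
  by congr (_ + _)%R; apply: eq_bigr => i _; rewrite tnthS.
have mLs : measurable_fun setT (fun u => L (s + u)%R).
  by apply: measurableT_comp => //; exact: measurable_funD.
rewrite ge0_integralZl//; last 2 first.
- apply: measurable_funTS; exact: (measurableT_comp mLs (mphi ord0)).
- by rewrite lee_fin exprn_ge0.
rewrite (H ord0 (fun u => L (s + u)%R))// exprSr EFinM -muleA.
congr (_ * (_ * _)); apply: eq_integral => y _; rewrite LE.
apply: eq_integral => t _; congr (G _); rewrite big_ord_recl addrA.
by congr (_ + _)%R; apply: eq_bigr => i _; rewrite tnthS.
Qed.

End tuple_integrals.

(** * The connection probability *)

Section connection_probability.
Context {R : realType} (d : nat).
Local Notation leb := (@lebesgue_tuple R d).

(** The minimization over the lattice splits into one minimization per coordinate. *)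
Lemma torus_distE (x y : d.-tuple R) :
  torus_dist x y = Num.sqrt (\sum_(i < d) circle_dist (tnth x i - tnth y i) ^+ 2).
Proof.
rewrite /torus_dist; set S := (X in inf X).
have lb : lbound S (Num.sqrt (\sum_(i < d) circle_dist (tnth x i - tnth y i) ^+ 2)).
  move=> _ [z _ <-]; rewrite /enorm ler_wsqrtr//; apply: ler_sum => i _.
  rewrite tnth_mktuple -[leRHS]real_normK ?num_real// ler_sqr ?nnegrE//;
    last exact: normr_ge0.
  exact: circle_dist_le.
have mem : S (Num.sqrt (\sum_(i < d) circle_dist (tnth x i - tnth y i) ^+ 2)).
  exists [tuple Num.ceil (tnth x i - tnth y i - 2^-1) | i < d] => //.
  congr Num.sqrt; apply: eq_bigr => i _; rewrite !tnth_mktuple.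
  by rewrite /circle_dist real_normK ?num_real.
apply/eqP; rewrite eq_le; apply/andP; split.
  apply: ge_inf mem.
  by exists (Num.sqrt (\sum_(i < d) circle_dist (tnth x i - tnth y i) ^+ 2)).
by apply: lb_le_inf => //; eexists; exact: mem.
Qed.

Variables (g : R -> R).
Hypotheses (g01 : forall x, 0 <= x -> 0 <= g x <= 1)
  (g_noninc : forall x y, 0 <= x -> x <= y -> g y <= g x).

(** The squared torus distance is a sum over the coordinates, hence the use of the
    connection function of a squared distance. *)
Definition sq_profile (s : R) : R := g (Num.sqrt s).

Lemma sq_profile01 s : 0 <= sq_profile s <= 1.
Proof. exact: g01. Qed.

Lemma measurable_sq_profile : measurable_fun setT sq_profile.
Proof.
apply: nonincreasing_measurable => // x y xy.
by apply: g_noninc => //; exact: ler_wsqrtr.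
Qed.

Lemma profile_torus_dist (r : R) x y : 0 < r ->
  g (torus_dist x y / r) = sq_profile
    (0 + \sum_(i < d) circle_dist (tnth x i - tnth y i) ^+ 2 / r ^+ 2).
Proof.
move=> r0; rewrite torus_distE /sq_profile add0r -mulr_suml sqrtrM; last first.
  by apply: sumr_ge0 => i _; exact: sqr_ge0.
by rewrite sqrtrV ?sqr_ge0// sqrtr_sqr gtr0_norm.
Qed.

(** The part of the integral of g(|x|) over the cube of half-side rho. The shape of
    the argument is that of [integral_tuple_box_sum] with offset 0. *)
Definition box_mass (rho : R) : \bar R :=
  (\int[leb]_(t in tuple_box `](- rho)%R, rho%R])
     (sq_profile (0 + \sum_(i < d) tnth t i ^+ 2))%:E)%E.

Lemma torusE : @torus R d = tuple_box `](- 2^-1), 2^-1]%classic.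
Proof. by apply/seteqP; split => t /= h i; have := h i; rewrite /= in_itv. Qed.

Lemma measurable_torus : measurable (@torus R d).
Proof. by rewrite torusE; exact: measurable_tuple_box. Qed.

(** This does not depend on x: the homogeneity of the torus comes from
    [integral_circle] in each coordinate. *)
Lemma integral_torus_profile (r : R) (x : d.-tuple R) : 0 < r ->
  (\int[leb]_(y in @torus R d) (g (torus_dist x y / r))%:E =
   (r ^+ d)%:E * box_mass (2^-1 / r))%E.
Proof.
move=> r0; under eq_integral do rewrite profile_torus_dist//.
rewrite torusE /box_mass -mulNr.
apply: (@integral_tuple_box_sum R `](- 2^-1), 2^-1]%classic
  `](- 2^-1 / r), (2^-1 / r)]%classic r (fun y => y ^+ 2) (ltW r0) _ _ _ d
  (fun i y => circle_dist (tnth x i - y) ^+ 2 / r ^+ 2) (EFin \o sq_profile) 0).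
- by [].
- by [].
- exact: measurable_funX.
- move=> i; apply: measurable_funM => //; apply: measurable_funX.
  apply: (measurableT_comp measurable_circle_dist).
  exact: measurable_funB.
- by move=> i f mf f0; exact: integral_circle.
- by apply/measurable_EFinP; exact: measurable_sq_profile.
- by move=> s; rewrite lee_fin; have /andP[] := sq_profile01 s.
Qed.

Variables (mu : probability (d.-tuple R) R) (nu : probability R R).
Hypotheses (mu_torus : forall A, measurable A -> mu A = uniform_torus A)
  (nu_unif : forall A, measurable A -> nu A = uniform_prob (@ltr01 R) A).

Lemma integral_uniform_torus (f : d.-tuple R -> \bar R) :
  measurable_fun setT f -> (forall t, 0 <= f t)%E ->
  (\int[mu]_t f t = \int[leb]_(t in @torus R d) f t)%E.
Proof.
move=> mf f0; have mT := measurable_torus.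
rewrite -(setUv (@torus R d)) ge0_integral_setU//=; last 3 first.
- exact: measurableC.
- by rewrite setUv.
- exact/disj_setPCl.
rewrite [X in (_ + X)%E](_ : _ = 0%E) ?adde0.
  apply: eq_measure_integral => A mA AT.
  by apply: (etrans (mu_torus mA)); rewrite /uniform_torus setIidl.
rewrite (eq_measure_integral mzero) ?integral_measure_zero// => A mA AT.
apply: (etrans (mu_torus mA));
  rewrite /uniform_torus /mzero [X in lebesgue_tuple _ X](_ : _ = set0).
  by rewrite measure0.
by apply/seteqP; split => // t [/AT].
Qed.

Lemma uniform_prob_le (t : R) : 0 <= t <= 1 -> nu [set u | u <= t] = t%:E.
Proof.
move=> /andP[t0 t1].
have -> : [set u | u <= t] = `]-oo, t]%classic.
  by apply/seteqP; split => u /=; rewrite in_itv.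
rewrite nu_unif// /uniform_prob integral_uniform_pdf.
have -> : `]-oo, t] `&` `[0, 1] = `[0, t]%classic.
  by apply/seteqP; split => u /=; rewrite !in_itv/=; lra.
rewrite (eq_integral (cst 1%E)); last first.
  move=> u; rewrite inE /= in_itv /= => /andP[u0 ut].
  by rewrite /uniform_pdf u0 (le_trans ut t1) subr0 invr1.
rewrite integral_cst//= mul1e lebesgue_measure_itv /= lte_fin.
by case: ltgtP t0 => // [_ _|<- _]; rewrite ?sube0.
Qed.

Let Gd (r : R) (z : d.-tuple R * d.-tuple R) : R := sq_profile
    (0 + \sum_(i < d) circle_dist (tnth z.1 i - tnth z.2 i) ^+ 2 / r ^+ 2).

Let Gd_ge0 r z : (0 <= (Gd r z)%:E)%E.
Proof. by rewrite lee_fin; have /andP[] := sq_profile01 (0 + \sum_(i < d)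
  circle_dist (tnth z.1 i - tnth z.2 i) ^+ 2 / r ^+ 2). Qed.

Let mGd r : measurable_fun setT (Gd r).
Proof.
apply: (measurableT_comp measurable_sq_profile).
apply: measurable_funD => //; apply: measurable_sum => i.
apply: measurable_funM => //; apply: measurable_funX.
apply: (measurableT_comp measurable_circle_dist).
apply: measurable_funB.
  exact: (measurableT_comp (measurable_tnth i) measurable_fst).
exact: (measurableT_comp (measurable_tnth i) measurable_snd).
Qed.

Lemma measurable_connection_set (r : R) : 0 < r ->
  measurable (@connection_set R d g r).
Proof.
move=> r0; have -> : @connection_set R d g r =
    (fun z => Gd r z.1 - z.2) @^-1` `[0, +oo[.
  apply/seteqP; split => -[[x y] u]; rewrite /connection_set /=;
    by rewrite in_itv/= andbT profile_torus_dist// subr_ge0.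
rewrite -[X in measurable X]setTI.
suff m : measurable_fun setT (fun z : d.-tuple R * d.-tuple R * R => Gd r z.1 - z.2).
  exact: m.
apply: measurable_funB => //.
exact: (measurableT_comp (mGd r) measurable_fst).
Qed.

(** The probability that two independent uniform points of the torus are joined at
    scale r; the cube of side 1 has become one of half-side 1 / (2 r). *)
Definition connection_prob (r : R) : R := fine ((r ^+ d)%:E * box_mass (2^-1 / r))%E.

Let integral_mu_profile (r : R) x : 0 < r ->
  (\int[mu]_y (Gd r (x, y))%:E = (r ^+ d)%:E * box_mass (2^-1 / r))%E.
Proof.
move=> r0; rewrite integral_uniform_torus.
- rewrite -(integral_torus_profile x)//.
  by apply: eq_integral => y _; rewrite profile_torus_dist.
- apply/measurable_EFinP.
  rewrite -[X in measurable_fun _ X]/(Gd r \o (fun y => (x, y))).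
  by apply: measurableT_comp => //; exact: measurable_fun_pair.
- by move=> t; exact: Gd_ge0.
Qed.

Lemma connection_probE (r : R) : 0 < r ->
  (connection_prob r)%:E = ((r ^+ d)%:E * box_mass (2^-1 / r))%E /\
  0 <= connection_prob r <= 1.
Proof.
move=> r0; have := integral_mu_profile [tuple 0 | _ < d] r0.
set I := (\int[mu]_y _)%E; move=> IE.
have I0 : (0 <= I)%E.
  by apply: integral_ge0 => y _; exact: Gd_ge0.
have I1 : (I <= 1)%E.
  apply: (@le_trans _ _ (\int[mu]_y (cst 1%E) y)%E).
    apply: ge0_le_integral => //.
    - apply/measurable_EFinP.
      rewrite -[X in measurable_fun _ X]/(Gd r \o (fun y => ([tuple 0 | _ < d], y))).
      by apply: measurableT_comp => //; exact: measurable_fun_pair.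
    - by move=> y _; rewrite lee_fin; have /andP[] := sq_profile01
        (0 + \sum_(i < d)
          circle_dist (tnth [tuple (0 : R) | _ < d] i - tnth y i) ^+ 2 / r ^+ 2).
  by rewrite integral_cst// mul1e; exact: (probability_le1 mu measurableT).
have Ifin : I \is a fin_num by rewrite ge0_fin_numE// (le_lt_trans I1) ?ltry.
rewrite /connection_prob -IE fineK//; split => //.
by rewrite -!lee_fin fineK// I0.
Qed.

(** A vertex is joined to another one with a probability that does not depend on
    its own position. This is what [star_independence] asks for. *)
Lemma connection_set_law (r : R) (C : set (d.-tuple R)) : 0 < r -> measurable C ->
  ((mu \x mu) \x nu)%E (@connection_set R d g r `&` [set z | C z.1.1]) =
  (mu C * (connection_prob r)%:E)%E.
Proof.
move=> r0 mC; have [pE p01] := connection_probE r0.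
transitivity (\int[mu \x mu]_z
  nu (xsection (@connection_set R d g r `&` [set z | C z.1.1]) z))%E; first by [].
transitivity (\int[mu \x mu]_z (\1_C z.1 * Gd r z)%:E)%E.
  apply: eq_integral => -[x y] _.
  have [xC|xC] := boolP (x \in C).
    rewrite indicE xC mul1r -uniform_prob_le; last exact: sq_profile01.
    congr (nu _); apply/seteqP; split => u; rewrite /xsection /= inE /=;
      rewrite /connection_set /= profile_torus_dist//.
    + by case.
    + by move=> ?; split => //; rewrite inE in xC.
  rewrite indicE (negbTE xC) mul0r -[RHS](measure0 nu); congr (nu _).
  apply/seteqP; split => // u; rewrite /xsection /= inE => -[_ /= Cx].
  by move: xC; rewrite mem_set.
rewrite fubini_tonelli1.
- transitivity (\int[mu]_x ((connection_prob r)%:E * (\1_C x)%:E))%E.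
    apply: eq_integral => x _; rewrite /fubini_F /=.
    under eq_integral do rewrite EFinM.
    rewrite ge0_integralZl//.
    + by rewrite integral_mu_profile// -pE muleC.
    + apply/measurable_EFinP.
      rewrite -[X in measurable_fun _ X]/(Gd r \o (fun y => (x, y))).
      by apply: measurableT_comp => //; exact: measurable_fun_pair.
  rewrite ge0_integralZl//; last 2 first.
  - by apply/measurable_EFinP; exact: measurable_indic.
  - by rewrite lee_fin; case/andP: p01.
  by rewrite integral_indic// setIT muleC.
- apply/measurable_EFinP; apply: measurable_funM => //.
  apply: (measurableT_comp _ measurable_fst); exact: measurable_indic.
- move=> z; rewrite lee_fin mulr_ge0 ?indicE//.
  by rewrite -lee_fin; exact: Gd_ge0.
Qed.

End connection_probability.

(** * The tail of the connection function *)

Section tuple_products.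
Context {R : realType}.
Local Notation mu := (@lebesgue_measure R).

Lemma integral_tuple_prod n (w : 'I_n -> R -> R) :
  (forall i, measurable_fun setT (w i)) -> (forall i x, 0 <= w i x) ->
  (\int[lebesgue_tuple n]_t (\prod_(i < n) w i (tnth t i))%:E =
   \prod_(i < n) \int[mu]_y (w i y)%:E)%E.
Proof.
have mprod m (v : 'I_m -> R -> R) : (forall i, measurable_fun setT (v i)) ->
    measurable_fun setT (fun t : m.-tuple R => (\prod_(i < m) v i (tnth t i))%:E).
  move=> mv; apply/measurable_EFinP; apply: measurable_prod => i _.
  exact: (measurableT_comp (mv i) (measurable_tnth i)).
elim: n w => [|n IH] w mw w0.
  rewrite big_ord0; under eq_integral do rewrite big_ord0.
  by rewrite integral_dirac// diracT mul1e.
rewrite integral_lebesgue_tupleS; last 2 first.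
- exact: mprod.
- by move=> t; rewrite lee_fin; apply: prodr_ge0.
rewrite big_ord_recl -(IH (fun i => w (lift ord0 i)))//.
set I := (\int[lebesgue_tuple n]_t _)%E.
have I0 : (0 <= I)%E.
  by apply: integral_ge0 => t _; rewrite lee_fin; apply: prodr_ge0.
transitivity (\int[mu]_y (I * (w ord0 y)%:E))%E.
  apply: eq_integral => y _; rewrite muleC.
  rewrite -ge0_integralZl//.
  - apply: eq_integral => t _; rewrite -EFinM big_ord_recl; congr (_ * _)%:E.
    by apply: eq_bigr => i _; rewrite tnthS.
  - exact: (mprod n (fun i => w (lift ord0 i))).
  - by move=> t _; rewrite lee_fin; apply: prodr_ge0.
  - by rewrite lee_fin.
rewrite ge0_integralZl//; first exact: muleC.
- by apply/measurable_EFinP; exact: mw.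
- by move=> y _; rewrite lee_fin.
Qed.

End tuple_products.

Lemma ln_cvgy {R : realType} : @ln R x @[x --> +oo] --> +oo.
Proof.
apply/cvgryPge => A; near=> x.
have ex : expR A <= x by near: x; exact: nbhs_pinfty_ge.
rewrite -(expRK A) ler_ln// posrE ?expR_gt0//.
Unshelve. all: by end_near. Qed.

Section power_weight.
Context {R : realType} (b : R).
Hypothesis b1 : 1 < b.
Local Notation mu := (@lebesgue_measure R).

(** A weight on |y| >= rho, written with two half-line indicators because its
    integral is computed on each half-line. *)
Definition power_weight (rho y : R) : R :=
  (\1_`[rho, +oo[ y + \1_`]-oo, - rho] y) * (1 + `|y|) `^ (- b).

Lemma power_weight_ge0 rho y : 0 <= power_weight rho y.
Proof. by rewrite mulr_ge0 ?powR_ge0// addr_ge0// indicE. Qed.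

Let cpw : continuous (fun y : R => (1 + `|y|) `^ (- b)).
Proof.
move=> y; apply: (@continuous_comp _ _ _ (fun y : R => 1 + `|y|) (fun x => x `^ (- b))).
  by apply: cvgD; [exact: cvg_cst|exact: norm_continuous].
apply: differentiable_continuous; apply/derivable1_diffP.
by apply: derivable_powR; rewrite in_itv/= andbT ltr_wpDr.
Qed.

Let mpw : measurable_fun setT (fun y : R => (1 + `|y|) `^ (- b)).
Proof. exact: continuous_measurable_fun. Qed.

Lemma measurable_power_weight rho : measurable_fun setT (power_weight rho).
Proof.
apply: measurable_funM => //.
by apply: measurable_funD; exact: measurable_indic.
Qed.

Lemma power_weight_ge rho y : rho <= `|y| ->
  (1 + `|y|) `^ (- b) <= power_weight rho y.
Proof.
move=> ry; rewrite ler_peMl ?powR_ge0// !indicE !mem_setE !in_itv /= andbT.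
move: ry; rewrite ler_normr => /orP[->|]; first by rewrite lerDl.
by rewrite lerNr => ->; rewrite lerDr.
Qed.

Let half (rho : R) : 0 <= rho ->
  (\int[mu]_(y in `[rho, +oo[) ((1 + y) `^ (- b))%:E =
   ((1 + rho) `^ (1 - b) / (b - 1))%:E)%E.
Proof.
move=> r0; have d1 (y : R) : is_derive y 1 (fun y : R => 1 + y) 1.
  have := is_deriveD (is_derive_cst (1 : R) y (1 : R)) (is_derive_id y (1 : R)).
  by rewrite add0r.
pose F (y : R) : R := - ((b - 1)^-1 * (1 + y) `^ (1 - b)).
have dF (y : R) : 0 <= y -> is_derive y 1 F ((1 + y) `^ (- b)).
  move=> y0; have y1 : 0 < 1 + y by lra.
  have := @is_derive1_comp R (fun x => x `^ (1 - b)) _ y _ _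
    (is_derive1_powR (1 - b) y1) (d1 y).
  move=> /(@is_deriveZ R R R _ (- (b - 1)^-1) y 1 _).
  rewrite (_ : _ \*: _ = F); last first.
    by apply/funext => x; rewrite /F -mulNr.
  congr is_derive; rewrite /GRing.scale /= mulr1.
  have -> : 1 - b - 1 = - b by lra.
  by field; rewrite subr_eq0 gt_eqF.
rewrite (@ge0_continuous_FTC2y _ _ F _ 0).
- by rewrite sub0e /F EFinN oppeK mulrC.
- by move=> y _; exact: powR_ge0.
- apply: derivable_within_continuous => y; rewrite in_itv/= andbT => ry.
  have y1 : 0 < 1 + y by lra.
  by have [] := @is_derive1_comp R (fun x => x `^ (- b)) _ y _ _
    (is_derive1_powR (- b) y1) (d1 y).
- rewrite -oppr0 -[X in - X](mulr0 (b - 1)^-1); apply: cvgN; apply: cvgMr.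
  apply: (@cvg_trans _ (expR (- ((b - 1) * ln (1 + y))) @[y --> +oo])).
    apply: near_eq_cvg; near=> y; have y0 : 0 < y by [].
    rewrite /powR gt_eqF; last by lra.
    by rewrite -mulNr opprB.
  apply: (@cvg_comp _ _ _ (fun y => (b - 1) * ln (1 + y)) (fun x => expR (- x)));
    last exact: cvgr_expR.
  apply: gt0_cvgMry; first by rewrite subr_gt0.
  apply: (@cvg_comp _ _ _ (fun y => 1 + y) (@ln R)); last exact: ln_cvgy.
  exact: cvg_addrl.
- by move=> y ry; have [] := dF y ltac:(lra).
- apply: cvg_at_right_filter; apply: differentiable_continuous.
  by apply/derivable1_diffP; have [] := dF rho r0.
- move=> y; rewrite in_itv/= andbT => ry; rewrite derive1E.
  exact: (@derive_val _ _ _ _ _ _ _ (dF y ltac:(lra))).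
Unshelve. all: by end_near. Qed.

Lemma integral_power_weight rho : 0 <= rho ->
  (\int[mu]_y (power_weight rho y)%:E =
   (2 / (b - 1) * (1 + rho) `^ (1 - b))%:E)%E.
Proof.
move=> r0.
have mI (A : set R) : measurable A -> measurable_fun setT
    (fun y : R => ((\1_A y) * (1 + `|y|) `^ (- b))%:E).
  by move=> mA; apply/measurable_EFinP; apply: measurable_funM.
have iE (A : set R) : measurable A ->
    (\int[mu]_y ((\1_A y) * (1 + `|y|) `^ (- b))%:E =
     \int[mu]_(y in A) ((1 + `|y|) `^ (- b))%:E)%E.
  move=> mA; rewrite [RHS]integral_mkcond; apply: eq_integral => y _.
  by rewrite patchE indicE; case: (y \in A); rewrite ?mul1r ?mul0r.
under eq_integral do rewrite /power_weight mulrDl EFinD.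
rewrite ge0_integralD//; [|exact: mI|exact: mI].
rewrite !iE// ge0_integration_by_substitutionNy; last 2 first.
- exact: continuous_subspaceT.
- by move=> y _; exact: powR_ge0.
have e1 : (\int[mu]_(y in `[rho, +oo[) ((1 + `|y|) `^ (- b))%:E =
   ((1 + rho) `^ (1 - b) / (b - 1))%:E)%E.
  rewrite -(half r0); apply: eq_integral => y; rewrite inE /= in_itv /= andbT => ry.
  by rewrite ger0_norm// (le_trans r0).
rewrite e1 (_ : \int[mu]_(x in `[rho, +oo[) _ = ((1 + rho) `^ (1 - b) / (b - 1))%:E)%E.
  by rewrite -EFinD; congr EFin; ring.
by rewrite -e1; apply: eq_integral => y _ /=; rewrite normrN.
Qed.

End power_weight.

Section box_tail.
Context {R : realType} (d : nat) (g : R -> R) (c T : R).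
Local Notation leb := (@lebesgue_tuple R d).
Hypotheses (d0 : (0 < d)%N) (dc : d%:R < c)
  (g01 : forall x, 0 <= x -> 0 <= g x <= 1)
  (g_noninc : forall x y, 0 <= x -> x <= y -> g y <= g x)
  (gT : forall x, T <= x -> g x <= x `^ (- c)).

Let b : R := c / d%:R.
Let d0R : 0 < d%:R :> R. Proof. by rewrite ltr0n. Qed.
Let b1 : 1 < b. Proof. by rewrite /b ltr_pdivlMr// mul1r. Qed.

(** Outside the cube some coordinate is at least rho in absolute value, so the norm
    N is at least T and g(N) <= N^(-c), which is the d-th power of N^(-b) with
    b = c / d > 1. As 1 + |t j| <= 2 N for all j, this is at most a product of
    one-dimensional weights, each of them integrable. *)
Lemma profile_le_power_weights (rho : R) (t : d.-tuple R) : T <= rho -> 1 <= rho ->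
  ~ tuple_box `](- rho), rho]%classic t ->
  sq_profile g (0 + \sum_(i < d) tnth t i ^+ 2) <=
  2 `^ c * \sum_(i < d) \prod_(j < d)
    power_weight b (if j == i then rho else 0) (tnth t j).
Proof.
move=> Tr r1 tbox.
have [i ti] : exists i, rho <= `|tnth t i|.
  apply: contrapT => h; apply: tbox => i; rewrite /= in_itv /=.
  have : ~ rho <= `|tnth t i| by move=> ?; apply: h; exists i.
  by move=> /negP; rewrite -ltNge ltr_norml => /andP[-> /ltW].
rewrite add0r /sq_profile; set N : R := Num.sqrt _.
have tN j : `|tnth t j| <= N.
  rewrite -sqrtr_sqr ler_wsqrtr// (bigD1 j)//= lerDl.
  by apply: sumr_ge0 => ? _; exact: sqr_ge0.
have rN : rho <= N := le_trans ti (tN i).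
have N0 : 0 < N by lra.
apply: (le_trans (gT (le_trans Tr rN))).
apply: (@le_trans _ _ (2 `^ c * \prod_(j < d) (1 + `|tnth t j|) `^ (- b))).
  have -> : N `^ (- c) = 2 `^ c * \prod_(j < d) (2 * N) `^ (- b).
    rewrite prodr_const card_ord -powR_mulrn ?powR_ge0// -powRrM.
    have -> : - b * d%:R = - c by rewrite /b mulNr divfK// gt_eqF.
    rewrite powRM ?ltW// mulrA -powRD; last by rewrite pnatr_eq0 implybT.
    by rewrite subrr powRr0 mul1r.
  rewrite ler_wpM2l ?powR_ge0//; apply: ler_prod => j _.
  have n0 := normr_ge0 (tnth t j); have nN := tN j.
  have h1 : 0 < 2 * N by lra.
  have h2 : 0 < 1 + `|tnth t j| by lra.
  rewrite powR_ge0 /= !powRN lef_pV2 ?posrE ?powR_gt0//.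
  apply: ge0_ler_powR; rewrite ?nnegrE; [|lra|lra|lra].
  by rewrite ltW// (lt_trans ltr01 b1).
rewrite ler_wpM2l ?powR_ge0//.
rewrite [leRHS](bigD1 i)//= ler_wpDr//.
  by apply: sumr_ge0 => k _; apply: prodr_ge0 => j _; exact: power_weight_ge0.
apply: ler_prod => j _; rewrite powR_ge0 /=.
by apply: power_weight_ge => //; case: eqP => // ->.
Qed.

Definition tail_const : R :=
  2 `^ c * d%:R * (2 / (b - 1)) * (2 / (b - 1)) ^+ d.-1.

Lemma box_tail (rho : R) : T <= rho -> 1 <= rho ->
  (\int[leb]_(t in ~` tuple_box `](- rho)%R, rho%R])
     (sq_profile g (0 + \sum_(i < d) tnth t i ^+ 2))%:E <=
   (tail_const * (1 + rho) `^ (1 - b))%:E)%E.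
Proof.
move=> Tr r1; have r0 : 0 <= rho by lra.
pose h i (t : d.-tuple R) : R := \prod_(j < d)
    power_weight b (if j == i then rho else 0) (tnth t j).
have h0 i t : 0 <= h i t by apply: prodr_ge0 => j _; exact: power_weight_ge0.
have mh i : measurable_fun setT (h i).
  apply: measurable_prod => j _.
  exact: (measurableT_comp (measurable_power_weight b _) (measurable_tnth j)).
have msum : measurable_fun setT (fun t => 2 `^ c * \sum_(i < d) h i t).
  by apply: measurable_funM => //; exact: measurable_sum.
have mbox : measurable (~` @tuple_box R d `](- rho)%R, rho%R]%classic).
  by apply: measurableC; exact: measurable_tuple_box.
have mprof : measurable_fun setT
    (fun t : d.-tuple R => sq_profile g (0 + \sum_(i < d) tnth t i ^+ 2)).
  apply: (measurableT_comp (measurable_sq_profile g_noninc)).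
  apply: measurable_funD => //; apply: measurable_sum => i.
  by apply: measurable_funX; exact: measurable_tnth.
apply: (@le_trans _ _ (\int[leb]_t (2 `^ c * \sum_(i < d) h i t)%:E)%E).
  apply: (@le_trans _ _ (\int[leb]_(t in ~` tuple_box `](- rho)%R, rho%R])
      (2 `^ c * \sum_(i < d) h i t)%:E)%E).
    apply: ge0_le_integral => //.
    - by move=> t _; rewrite lee_fin; have /andP[] := sq_profile01 g01
        (0 + \sum_(i < d) tnth t i ^+ 2).
    - by apply: measurable_funTS; apply/measurable_EFinP.
    - by apply: measurable_funTS; apply/measurable_EFinP.
    - by move=> t tbox; rewrite lee_fin; exact: profile_le_power_weights.
  apply: ge0_subset_integral => //; first exact/measurable_EFinP.
  by move=> t _; rewrite lee_fin mulr_ge0 ?powR_ge0// sumr_ge0.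
have int_h i : (\int[leb]_t (h i t)%:E =
   ((2 / (b - 1) * (1 + rho) `^ (1 - b)) * (2 / (b - 1)) ^+ d.-1)%:E)%E.
  rewrite (@integral_tuple_prod _ _
    (fun j => power_weight b (if j == i then rho else 0))).
  - transitivity (\prod_(j < d) (2 / (b - 1) *
       (1 + (if j == i then rho else 0)) `^ (1 - b))%:E)%E.
      by apply: eq_bigr => j _; rewrite integral_power_weight//; case: ifP.
    rewrite prodEFin (bigD1 i)//= eqxx; congr (_ * _)%:E.
    under eq_bigr => j /negbTE ->.
      rewrite addr0 powR1 mulr1; over.
    by rewrite prodr_const cardC1 card_ord.
  - by move=> j; exact: measurable_power_weight.
  - by move=> j y; exact: power_weight_ge0.
under eq_integral do rewrite EFinM.
rewrite ge0_integralZl//; last 2 first.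
- by apply/measurable_EFinP; exact: measurable_sum.
- by move=> t _; rewrite lee_fin sumr_ge0.
under eq_integral do rewrite -sumEFin.
rewrite ge0_integral_sum//; last 2 first.
- by move=> i; apply/measurable_EFinP; exact: mh.
- by move=> i t _; rewrite lee_fin.
under eq_bigr do rewrite int_h.
rewrite sumEFin -EFinM sumr_const card_ord lee_fin /tail_const -mulr_natl.
by rewrite le_eqVlt; apply/orP; left; apply/eqP; ring.
Qed.

Lemma box_mass_bounds (alpha rho : R) :
  (\int[leb]_x (g (enorm x))%:E = alpha%:E)%E -> T <= rho -> 1 <= rho ->
  exists2 m, box_mass d g rho = m%:E &
    0 <= alpha - m <= tail_const * (1 + rho) `^ (1 - b).
Proof.
move=> aE Tr r1; have tl := box_tail Tr r1.
set B := @tuple_box R d `](- rho)%R, rho%R]%classic in tl *.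
have mB : measurable B by exact: measurable_tuple_box.
have mprof : measurable_fun setT
    (fun t : d.-tuple R => (sq_profile g (0 + \sum_(i < d) tnth t i ^+ 2))%:E).
  apply/measurable_EFinP; apply: (measurableT_comp (measurable_sq_profile g_noninc)).
  apply: measurable_funD => //; apply: measurable_sum => i.
  by apply: measurable_funX; exact: measurable_tnth.
have pos t : (0 <= (sq_profile g (0 + \sum_(i < d) tnth t i ^+ 2))%:E)%E.
  by rewrite lee_fin; have /andP[] := sq_profile01 g01
    (0 + \sum_(i < d) tnth t i ^+ 2).
have split_int : (alpha%:E = box_mass d g rho + \int[leb]_(t in ~` B)
     (sq_profile g (0 + \sum_(i < d) tnth t i ^+ 2))%:E)%E.
  rewrite -aE /box_mass -/B -ge0_integral_setU//=.
  - by rewrite setUv; apply: eq_integral => t _; rewrite add0r.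
  - exact: measurableC.
  - by rewrite setUv.
  - exact/disj_setPCl.
have t0 : (0 <= \int[leb]_(t in ~` B)
     (sq_profile g (0 + \sum_(i < d) tnth t i ^+ 2))%:E)%E by exact: integral_ge0.
have m0 : (0 <= box_mass d g rho)%E by exact: integral_ge0.
move: split_int tl t0 m0; set M := box_mass d g rho.
set I := (\int[leb]_(t in ~` B) _)%E.
case: M => [m| |]; case: I => [i| |] //=; rewrite -?EFinD => -[->].
rewrite !lee_fin => tl i0 m0; exists m => //.
by rewrite addrAC subrr add0r i0.
Qed.

End box_tail.

(** * The mean degree *)

Section mean_degree.
Context {R : realType} (d : nat) (g : R -> R) (c T alpha gamma : R).
Hypotheses (d0 : (0 < d)%N) (dc : d%:R < c)
  (g01 : forall x, 0 <= x -> 0 <= g x <= 1)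
  (g_noninc : forall x y, 0 <= x -> x <= y -> g y <= g x)
  (gT : forall x, T <= x -> g x <= x `^ (- c))
  (alphaE : (\int[lebesgue_tuple d]_x (g (enorm x))%:E = alpha%:E)%E)
  (alpha_gt0 : 0 < alpha) (gamma_gt0 : 0 < gamma).

Let b : R := c / d%:R.
Let d0R : (0 : R) < d%:R. Proof. by rewrite ltr0n. Qed.
Let b1 : 1 < b. Proof. by rewrite /b ltr_pdivlMr// mul1r. Qed.

Lemma ln_le_half (x : R) : 0 < x -> ln x <= x / 2.
Proof.
move=> x0; have -> : x = (1 + 1) * (1 + (x / 2 - 1)) by lra.
rewrite lnM ?posrE; [|lra|lra].
have h1 : ln (1 + 1) <= 1 :> R by apply: le_ln1Dx; lra.
have h2 : ln (1 + (x / 2 - 1)) <= x / 2 - 1 by apply: le_ln1Dx; lra.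
lra.
Qed.

Let K : R := 2 ^+ d * gamma / alpha.

(** The half-side of the rescaled cube grows like a power of n, because
    (1 / (2 r))^d = n / (K log n) and log (log n) is at most half of log n. *)
Lemma ln_inradius (n r : R) : 1 < n -> 0 < r -> r ^+ d = gamma * ln n / (alpha * n) ->
  (ln n / 2 - ln K) / d%:R <= ln (2^-1 / r).
Proof.
move=> n1 r0 rE; have n0 : 0 < n by lra.
have L0 : 0 < ln n by rewrite ln_gt0.
have K0 : 0 < K by rewrite !mulr_gt0 ?invr_gt0 ?exprn_gt0.
rewrite ler_pdivrMr// mulr_natr -lnXn ?divr_gt0//.
have -> : (2^-1 / r) ^+ d = n / (K * ln n).
  rewrite exprMn !exprVn rE /K; field.
  by rewrite !gt_eqF// exprn_gt0.
have KL0 : 0 < K * ln n by rewrite mulr_gt0.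
rewrite ln_div ?posrE//.
have -> : ln (K * ln n) = ln K + ln (ln n) by rewrite lnM ?posrE.
have := ln_le_half L0; lra.
Qed.

(** Exactly, n times the connection probability is (gamma / alpha) log n times the
    mass of the cube of half-side 1 / (2 r), so that the error is
    (gamma / alpha) log n times the mass outside this cube. The latter decays like a
    negative power of the half-side, hence of n, which beats log n. *)
Lemma mean_degree_cvg (rhat : nat -> R) :
  (forall n, (0 < n)%N -> 0 <= rhat n) ->
  (forall n, (0 < n)%N -> rhat n ^+ d = gamma * ln n%:R / (alpha * n%:R)) ->
  n%:R * connection_prob d g (rhat n) - gamma * ln n%:R @[n --> \oo] --> (0 : R).
Proof.
move=> r_ge0 rE.
have Loo : (ln n%:R : R) @[n --> \oo] --> +oo.
  by apply: (@cvg_comp _ _ _ (fun n => n%:R) (@ln R)); [exact: cvgr_idn|exact: ln_cvgy].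
(* the mass outside the cube is O(exp (- eta log n)), and exp x >= x^2 / 2 bounds
   it by a multiple of (log n)^(-2) *)
pose eta : R := (b - 1) / d%:R / 2.
have eta0 : 0 < eta by rewrite !divr_gt0// subr_gt0.
pose C : R := gamma / alpha * `|tail_const d c| * expR (2 * eta * ln K) * (2 / eta ^+ 2).
have Lc : C * (ln n%:R)^-1 @[n --> \oo] --> (0 : R).
  rewrite -[X in _ --> X](mulr0 C); apply: cvgMr; apply/gtr0_cvgV0 => //.
  near=> n; have : (1 < n%:R :> R) by rewrite ltr1n; near: n; exact: nbhs_infty_gt.
  exact: ln_gt0.
apply/norm_cvg0P.
apply: (@squeeze_cvgr _ _ _ _ (fun=> 0) (fun n => C * (ln n%:R)^-1)) => //;
  last exact: cvg_cst.
near=> n; rewrite normr_ge0 /=.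
have n1 : (1 < n)%N by near: n; exact: nbhs_infty_gt.
have n0 : (0 < n)%N by apply: leq_trans n1.
have n1R : 1 < n%:R :> R by rewrite ltr1n.
have n0R : 0 < n%:R :> R by lra.
have L0 : 0 < ln n%:R :> R by exact: ln_gt0.
have rd0 : 0 < rhat n ^+ d by rewrite rE// divr_gt0 ?mulr_gt0.
have r0 : 0 < rhat n.
  rewrite lt_neqAle r_ge0// andbT; apply/eqP => h.
  by move: rd0; rewrite -h expr0n gtn_eqF// ltxx.
have lnr := ln_inradius n1R r0 (rE n n0).
set L := ln n%:R in L0 lnr *.
set rho : R := 2^-1 / rhat n in lnr *.
have rho0 : 0 < rho by rewrite divr_gt0.
have big : Num.max T 1 <= rho.
  have m0 : 0 < Num.max T 1 by rewrite lt_max ltr01 orbT.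
  rewrite -ler_ln ?posrE//; apply: le_trans lnr.
  rewrite ler_pdivlMr// lerBrDr ler_pdivlMr//.
  by rewrite /L; near: n; exact: ((cvgryPge _).1 Loo).
have Trho : T <= rho by apply: le_trans big; rewrite le_max lexx.
have rho1 : 1 <= rho by apply: le_trans big; rewrite le_max lexx orbT.
have [m mE /andP[tl0 tl]] := box_mass_bounds d0 dc g01 g_noninc gT alphaE Trho rho1.
have -> : n%:R * connection_prob d g (rhat n) - gamma * L =
    - (gamma / alpha * L * (alpha - m)).
  rewrite /connection_prob -/rho mE -EFinM /= rE// -/L; field.
  by rewrite !gt_eqF.
have ga0 : 0 <= gamma / alpha * L by rewrite ltW// mulr_gt0// divr_gt0.
rewrite normrN ger0_norm; last exact: mulr_ge0.
have pw : (1 + rho) `^ (1 - b) <= expR (2 * eta * ln K) * expR (- (eta * L)).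
  rewrite -expRD /powR gt_eqF; last by lra.
  rewrite ler_expR.
  have l1 : ln rho <= ln (1 + rho) by rewrite ler_ln ?posrE; lra.
  have : 2 * eta * (L / 2 - ln K) <= (b - 1) * ln (1 + rho).
    apply: (@le_trans _ _ ((b - 1) * ln rho)); last first.
      by rewrite ler_wpM2l// ltW// subr_gt0.
    have -> : 2 * eta * (L / 2 - ln K) = (b - 1) * ((L / 2 - ln K) / d%:R).
      by rewrite /eta; field; exact: lt0r_neq0.
    by rewrite ler_wpM2l// ltW// subr_gt0.
  lra.
have ex : expR (- (eta * L)) <= 2 / eta ^+ 2 / L ^+ 2.
  have e0 : 0 <= eta * L by rewrite mulr_ge0// ltW.
  have := expR_ge1Dxn 1 e0; rewrite expRN (_ : 2`! = 2%N)//.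
  move=> h; have -> : 2 / eta ^+ 2 / L ^+ 2 = ((eta * L) ^+ 2 / 2)^-1.
    by field; rewrite !lt0r_neq0.
  rewrite lef_pV2 ?posrE ?expR_gt0//; last first.
    by rewrite divr_gt0// exprn_gt0// mulr_gt0.
  lra.
have tl' : alpha - m <= `|tail_const d c| *
    (expR (2 * eta * ln K) * (2 / eta ^+ 2 / L ^+ 2)).
  apply: (le_trans tl); apply: (@le_trans _ _ (`|tail_const d c| * (1 + rho) `^ (1 - b))).
    by rewrite ler_wpM2r ?powR_ge0// ler_norm.
  rewrite ler_wpM2l//; apply: (le_trans pw).
  by rewrite ler_wpM2l ?expR_ge0.
have : gamma / alpha * L * (alpha - m) <= gamma / alpha * L * (`|tail_const d c| *
    (expR (2 * eta * ln K) * (2 / eta ^+ 2 / L ^+ 2))).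
  by rewrite ler_wpM2l.
move/le_trans; apply; rewrite /C le_eqVlt; apply/orP; left; apply/eqP; field.
by rewrite !gt_eqF.
Unshelve. all: by end_near. Qed.

End mean_degree.

(** * Poisson upper tails *)

Section poisson_upper_tail.
Context {R : realType}.

(** The last integer smaller than x, for x > 2; the maximum with 1 keeps it positive
    in all cases, so that its square root can be a denominator. *)
Definition last_below (x : R) : nat := maxn 1 `|Num.ceil x|.-1.

Lemma last_below_gt0 x : (0 < last_below x)%N.
Proof. by rewrite /last_below leq_max. Qed.

Lemma last_belowP (x : R) : 2 < x ->
  [/\ forall l, (x <= l%:R) = (last_below x < l)%N,
      x - 1 <= (last_below x)%:R & (last_below x)%:R <= x].
Proof.
move=> x2; have /andP[c1 c2] := ceil_itv x.
have c0 : (2 < Num.ceil x)%R.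
  by rewrite -(ltr_int R); apply: lt_le_trans c2.
rewrite /last_below; case: (Num.ceil x) c0 c1 c2 (@ceil_le_int _ x) => // n n2 c1 c2 cle.
have n3 : (2 < n)%N by [].
have nE : maxn 1 `|Posz n|.-1 = n.-1.
  by apply/maxn_idPr; rewrite -ltnS prednK// (ltn_trans _ n3).
have n0 : (0 < n)%N by rewrite (ltn_trans _ n3).
have nR : n%:R = n.-1%:R + 1 :> R by rewrite natr1 prednK.
rewrite nE; split.
- move=> l; rewrite prednK//.
  by have := cle l; rewrite lez_nat => ->.
- move: c2; rewrite -pmulrn nR; lra.
- move: c1; rewrite intrB -pmulrn nR; lra.
Qed.

(** The tail from k on is 1 minus the distribution function at the last integer m
    below k = a + delta sqrt a. As lam = a + o(1) and m = k + O(1), also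
    sqrt m = sqrt a + O(1), and (lam - m) / sqrt m tends to - delta. *)
Lemma poisson_upper_tail_cvg (lam a : nat -> R) (delta : R) : 0 <= delta ->
  (forall n, 0 <= lam n) ->
  a n @[n --> \oo] --> +oo -> lam n - a n @[n --> \oo] --> (0 : R) ->
  (\sum_(l <oo | (a n + delta * Num.sqrt (a n) <= l%:R)%R)
      (lam n ^+ l / l`!%:R * expR (- lam n))%:E)%E @[n --> \oo] -->
  (1 - std_normal_cdf delta)%E.
Proof.
move=> delta0 lam0 aoo lama.
pose k n : R := a n + delta * Num.sqrt (a n).
pose mn n := last_below (k n).
have mn0 n : (0 < mn n)%N by exact: last_below_gt0.
have abig (A : R) : \forall n \near \oo, A <= a n by exact: (cvgryPge _).1.
have soo : (Num.sqrt (mn n)%:R : R) @[n --> \oo] --> +oo.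
  apply/cvgryPge => A; near=> n.
  have aA : `|A| ^+ 2 + 3 <= a n by near: n; exact: abig.
  have A0 : 0 <= `|A| ^+ 2 by exact: sqr_ge0.
  have ka : a n <= k n by rewrite lerDl mulr_ge0.
  have [|_ mk _] := @last_belowP (k n); first by lra.
  apply: (le_trans (ler_norm A)).
  rewrite -(ger0_norm (normr_ge0 A)) -sqrtr_sqr ler_wsqrtr//.
  move: mk; rewrite -/(mn n); lra.
have conv : (lam n - (mn n)%:R) / Num.sqrt (mn n)%:R @[n --> \oo] --> - delta.
  pose C : R := 2 + delta * (delta + 1).
  have Cs : C * (Num.sqrt (mn n)%:R)^-1 @[n --> \oo] --> (0 : R).
    rewrite -[X in _ --> X](mulr0 C); apply: cvgMr; apply/gtr0_cvgV0 => //.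
    by near=> n; rewrite sqrtr_gt0 ltr0n.
  rewrite -(add0r (- delta)).
  have -> : (fun n => (lam n - (mn n)%:R) / Num.sqrt (mn n)%:R) =
     (fun n => ((lam n - (mn n)%:R) / Num.sqrt (mn n)%:R + delta) + - delta).
    by apply/funext => n; rewrite addrK.
  apply: cvgD; last exact: cvg_cst.
  apply/norm_cvg0P.
  apply: (@squeeze_cvgr _ _ _ _ (fun=> 0) (fun n => C * (Num.sqrt (mn n)%:R)^-1)) => //;
    last exact: cvg_cst.
  near=> n; rewrite normr_ge0 /=.
  have a3 : 3 <= a n by near: n; exact: abig.
  have la1 : `|lam n - a n| <= 1.
    near: n; exact: (cvgr0_norm_le _ lama).
  have ka : a n <= k n by rewrite lerDl mulr_ge0.
  have [|_ mk km] := @last_belowP (k n); first by lra.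
  rewrite -/(mn n) in mk km.
  set s := Num.sqrt (mn n)%:R; set t := Num.sqrt (a n).
  have s0 : 0 < s by rewrite sqrtr_gt0 ltr0n.
  have s2 : (mn n)%:R = s ^+ 2 by rewrite sqr_sqrtr.
  have t2 : a n = t ^+ 2 by rewrite sqr_sqrtr//; lra.
  have t1 : 1 <= t by rewrite -[X in X <= _]sqrtr1 ler_wsqrtr//; lra.
  have kE : k n = t ^+ 2 + delta * t by rewrite /k -/t -t2.
  rewrite kE s2 in mk km; rewrite t2 in la1.
  (* sqrt a and sqrt m are at a bounded distance *)
  have ts : `|t - s| <= delta + 1.
    have ts0 : 0 < t + s by lra.
    rewrite -(ler_pM2r ts0) -[X in _ * X](gtr0_norm ts0) -normrM -subr_sqr.
    rewrite ler_norml; apply/andP; split; nra.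
  have -> : (lam n - (mn n)%:R) / s + delta =
     ((lam n - t ^+ 2) + (t ^+ 2 + delta * t - s ^+ 2) - delta * (t - s)) / s.
    by rewrite s2; field; rewrite lt0r_neq0.
  rewrite normrM normfV (gtr0_norm s0) ler_wpM2r ?invr_ge0 ?(ltW s0)//.
  apply: (le_trans (ler_normB _ _)); rewrite /C; apply: lerD.
    apply: (le_trans (ler_normD _ _)); rewrite -[X in _ <= X]/(1 + 1 :> R).
    apply: lerD => //; rewrite ler_norml; lra.
  by rewrite normrM ger0_norm// ler_wpM2l.
have clt := poisson_cdf_clt mn0 lam0 soo conv.
rewrite normal_prob_sym in clt.
have phi_fin : (std_normal_cdf delta : \bar R) \is a fin_num.
  exact: fin_num_measure.
move: clt; rewrite -(fineK phi_fin) => /fine_cvg clt.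
rewrite -EFinB; apply: (@cvg_trans _ ((1 - poisson_cdf (mn n) (lam n))%:E @[n --> \oo])).
  apply: near_eq_cvg; near=> n.
  have a3 : 3 <= a n by near: n; exact: abig.
  have ka : a n <= k n by rewrite lerDl mulr_ge0.
  have [|kl _ _] := @last_belowP (k n); first by lra.
  by rewrite (@poisson_tail _ (mn n)).
apply: cvg_EFin; first exact: nearW.
by apply: cvgB; [exact: cvg_cst|exact: clt].
Unshelve. all: by end_near. Qed.

End poisson_upper_tail.

(** * The proportion of vertices of high degree *)

Lemma littleo_powR_bound {R : realType} (g : R -> R) (c : R) :
  (g : R^o -> R^o) =o_ (pinfty_nbhs R) (fun r => r `^ (- c)) ->
  exists T, forall x, T <= x -> g x <= x `^ (- c).
Proof.
move=> /eqoP /(_ 1 ltr01) [T [_ hT]]; exists (T + 1) => x Tx.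
have := hT x ltac:(rewrite /=; lra); rewrite mul1r (ger0_norm (powR_ge0 _ _)).
exact: le_trans (ler_norm _).
Qed.

Theorem proposition2p4 (R : realType) (d : nat) (hd : (2 <= d)%N)
    (g : R -> R)
    (g01 : forall x, 0 <= x -> 0 <= g x <= 1)
    (g_noninc : forall x y, 0 <= x -> x <= y -> g y <= g x)
    (alpha : R)
    (alphaE : (\int[lebesgue_tuple d]_x (g (enorm x))%:E = alpha%:E)%E)
    (alpha_gt0 : 0 < alpha)
    (disp : measure_display) (Omega : measurableType disp)
    (P : probability Omega R)
    (X : nat -> {RV P >-> d.-tuple R})
    (N : nat -> {RV P >-> nat})
    (U : nat -> nat -> {RV P >-> R})
    (X_uniform : forall i A, measurable A ->
      distribution P (X i) A = uniform_torus A)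
    (X_indep : independent_RVs P [set: nat] X)
    (N_nondec : forall m n w, (0 < m)%N -> (m <= n)%N -> (N m w <= N n w)%N)
    (N_poisson : forall n A, (0 < n)%N ->
      distribution P (N n) A = poisson_prob n%:R 0 A)
    (U_uniform : forall i j A, (i < j)%N -> measurable A ->
      distribution P (U i j) A = uniform_prob (@ltr01 R) A)
    (U_indep : independent_RVs P [set ij : nat * nat | (ij.1 < ij.2)%N]
      (fun ij => U ij.1 ij.2))
    (XNU_indep : mutually_independent P [set: 'I_3]
      (tnth [tuple sigma_RVs [set: nat] X;
                   sigma_RVs [set n | (0 < n)%N] N;
                   sigma_RVs [set ij : nat * nat | (ij.1 < ij.2)%N]
                     (fun ij => U ij.1 ij.2)]))
    (gamma : R) (gamma_gt0 : 0 < gamma)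
    (rhat : nat -> R)
    (rhat_ge0 : forall n, (0 < n)%N -> 0 <= rhat n)
    (rhatE : forall n, (0 < n)%N ->
      rhat n ^+ d = gamma * ln n%:R / (alpha * n%:R))
    (c : R) (c_gt : d%:R < c)
    (g_littleo : (g : R^o -> R^o) =o_ (pinfty_nbhs R) (fun r => r `^ (- c)))
    (k : nat -> R)
    (kE : forall n, k n = alpha * n%:R * rhat n ^+ d
                        + d%:R * Num.sqrt (alpha * n%:R * rhat n ^+ d)) :
  ('E_P[fun w => ((num_degree_ge g (X ^~ w) (fun i j => U i j w) (N n w)
                     (rhat n) (k n))%:R / n%:R)%R])%E @[n --> \oo]
    --> (1 - std_normal_cdf d%:R)%E.
Proof.
have d0 : (0 < d)%N by apply: leq_trans hd.
have [T gT] := littleo_powR_bound g_littleo.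
(* the uniform laws, as probability measures rather than mere set functions *)
pose mu : probability (d.-tuple R) R := distribution P (X 0).
pose nu : probability R R := distribution P (U 0 1).
have X_law i A : measurable A -> distribution P (X i) A = mu A.
  by move=> mA; rewrite X_uniform// -(X_uniform 0).
have U_law i j A : (i < j)%N -> measurable A -> distribution P (U i j) A = nu A.
  by move=> ij mA; rewrite U_uniform// -(U_uniform 0 1).
have mu_torus A : measurable A -> mu A = uniform_torus A by exact: X_uniform.
have nu_unif A : measurable A -> nu A = uniform_prob (@ltr01 R) A by exact: U_uniform.
pose p n := connection_prob d g (rhat n).
have mean : n%:R * p n - gamma * ln n%:R @[n --> \oo] --> (0 : R).
  exact: (mean_degree_cvg d0 c_gt g01 g_noninc gT alphaE).
have aoo : gamma * (ln n%:R : R) @[n --> \oo] --> +oo.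
  apply: (@cvg_comp _ _ _ (fun n => n%:R) (fun x => gamma * ln x)).
    exact: cvgr_idn.
  by apply: gt0_cvgMry => //; exact: ln_cvgy.
have p0 n : 0 <= n%:R * p n.
  case: n => [|n]; first by rewrite mul0r.
  rewrite mulr_ge0// fine_ge0// mule_ge0 ?lee_fin ?exprn_ge0 ?rhat_ge0//.
  apply: integral_ge0 => t _; rewrite lee_fin.
  by have /andP[] := sq_profile01 g01 (0 + \sum_(i < d) tnth t i ^+ 2).
have := poisson_upper_tail_cvg (ler0n R d) p0 aoo mean.
apply: cvg_trans; apply: near_eq_cvg; near=> n.
have n1 : (1 < n)%N by near: n; exact: nbhs_infty_gt.
have n0 : (0 < n)%N by apply: leq_trans n1.
have n0R : 0 < n%:R :> R by rewrite ltr0n.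
have L0 : 0 < ln n%:R :> R by rewrite ln_gt0 ?ltr1n.
have r0 : 0 < rhat n.
  rewrite lt_neqAle rhat_ge0// andbT; apply/eqP => h.
  have : 0 < rhat n ^+ d by rewrite rhatE// divr_gt0 ?mulr_gt0.
  by rewrite -h expr0n gtn_eqF// ltxx.
have ar : alpha * n%:R * rhat n ^+ d = gamma * ln n%:R.
  by rewrite rhatE// mulrC divfK// gt_eqF// mulr_gt0.
have [_ p01] := connection_probE g01 g_noninc mu_torus r0.
have law C : measurable C ->
    (mu \x mu \x nu)%E (connection_set g (rhat n) `&` [set z | C z.1.1]) =
    (mu C * (p n)%:E)%E.
  by move=> mC; apply: connection_set_law.
rewrite (expected_num_degree_ge X_law X_indep N_poisson U_law U_indep XNU_indep
  (measurable_connection_set g_noninc r0) p01 law)//.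
by rewrite kE ar.
Unshelve. all: by end_near. Qed.
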